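(* Let $d \ge 1$, let $p_1, p_2$ be the projections from $\mathbb{R} \times \mathbb{R}^d$ onto $\mathbb{R}$ and $\mathbb{R}^d$ respectively, and let $\Gamma \subset \mathbb{R} \times \mathbb{R}^d$ be a lattice such that $p_1|_{\Gamma}$ is injective and $p_2(\Gamma)$ is dense in $\mathbb{R}^d$. Let $W, W' \subset \mathbb{R}^d$ be two bounded Riemann measurable sets (resp. two polytopes). If the one-dimensional model sets $\Lambda(\Gamma, W)$ and $\Lambda(\Gamma, W')$ are bounded distance equivalent, then $W$ and $W'$ are equidecomposable up to measure zero with Riemann measurable pieces (resp. with polytope pieces), using only translations from $p_2(\Gamma)$.
   Context: A lattice in $\mathbb{R} \times \mathbb{R}^d$ is a discrete subgroup of full rank $d+1$. For a bounded set $W \subset \mathbb{R}^d$, the model set is $\Lambda(\Gamma, W) = \{ p_1(\gamma) : \gamma \in \Gamma, \ p_2(\gamma) \in W \} \subset \mathbb{R}$. Two discrete point sets $\Lambda, \Lambda' \subset \mathbb{R}$ are bounded distance equivalent if there exist a constant $K > 0$ and a bijection $\chi : \Lambda \to \Lambda'$ with $|\chi(\lambda) - \lambda| \le K$ for all $\lambda \in \Lambda$. A bounded set is Riemann measurable if its boundary has Lebesgue measure zero. A polytope in $\mathbb{R}^d$ is any finite union of $d$-dimensional simplices with disjoint interiors (so it may be non-convex or disconnected). Let $G$ be a countable subgroup of $\mathbb{R}^d$. Two measurable sets $A, B \subset \mathbb{R}^d$ are equidecomposable up to measure zero with Riemann measurable (resp. polytope) pieces, using translations from $G$, if there exist finitely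 many bounded Riemann measurable sets (resp. polytopes) $A_1, \dots, A_k \subset \mathbb{R}^d$, vectors $g_1, \dots, g_k \in G$, and a set $X' \subset \mathbb{R}^d$ whose complement has Lebesgue measure zero, such that $\{A_j \cap X'\}_{j=1}^k$ is a partition of $A \cap X'$ and $\{(A_j + g_j) \cap X'\}_{j=1}^k$ is a partition of $B \cap X'$. *)

(* Defs.v *)
From mathcomp Require Import all_boot all_order all_algebra.
From mathcomp Require Import all_classical all_reals all_analysis.

Set Implicit Arguments.
Unset Strict Implicit.
Unset Printing Implicit Defensive.

Import Order.TTheory GRing.Theory Num.Theory.
Import numFieldNormedType.Exports.

Local Open Scope classical_set_scope.
Local Open Scope ring_scope.

Definition boundary (T : topologicalType) (A : set T) : set T :=
  closure A `\` interior A.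

Section Euclidean.
Context {R : realType} {d : nat}.
(* The library norm on ['rV[R]_d] is the sup norm; it only enters through the
   topology and through boundedness, which do not depend on the norm. *)
Local Notation V := 'rV[R]_d.

Definition box (a b : V) : set V :=
  [set x | forall i, a 0 i <= x 0 i <= b 0 i].

Definition box_volume (a b : V) : R := \prod_(i < d) (b 0 i - a 0 i).

(* Infimum of the total volumes of countable covers by closed boxes. The
   boxes may be degenerate, so finite covers are included; [a k <= b k] keeps
   the volumes nonnegative. *)
Definition lebesgue_outer_measure (A : set V) : \bar R :=
  ereal_inf [set s | exists a b : nat -> V,
    [/\ forall k i, a k 0 i <= b k 0 i,
        A `<=` \bigcup_k box (a k) (b k)
      & s = (\sum_(0 <= k <oo) (box_volume (a k) (b k))%:E)%E]].

Definition lebesgue_null (A : set V) : Prop := lebesgue_outer_measure A = 0%E.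

Definition riemann_measurable (A : set V) : Prop :=
  bounded_set A /\ lebesgue_null (boundary A).

Definition affinely_independent (v : 'I_d.+1 -> V) : Prop :=
  free [tuple v (lift ord0 i) - v ord0 | i < d].

Definition convex_hull (n : nat) (v : 'I_n -> V) : set V :=
  [set x | exists t : 'I_n -> R,
    [/\ forall i, 0 <= t i, \sum_(i < n) t i = 1
      & x = \sum_(i < n) t i *: v i]].

Definition simplex (S : set V) : Prop :=
  exists v : 'I_d.+1 -> V, affinely_independent v /\ S = convex_hull v.

Definition polytope (P : set V) : Prop :=
  exists (n : nat) (S : 'I_n -> set V),
    [/\ forall j, simplex (S j),
        trivIset setT (fun j => interior (S j))
      & P = \bigcup_j S j].

Definition translate (A : set V) (g : V) : set V := [set x + g | x in A].

(* The library's [partition] requires every part to be nonempty; [k] may be 0,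
   so that two null sets are equidecomposable. *)
Definition equidecomposable (pieces : set V -> Prop) (G A B : set V) : Prop :=
  exists (k : nat) (P : 'I_k -> set V) (g : 'I_k -> V) (X : set V),
    [/\ forall j, pieces (P j),
        forall j, G (g j),
        lebesgue_null (~` X),
        partition setT (fun j => P j `&` X) (A `&` X)
      & partition setT (fun j => translate (P j) (g j) `&` X) (B `&` X)].

Definition lattice (Gamma : set (R * V)) : Prop :=
  [/\ zmod_closed (fun x => x \in Gamma),
      Gamma `<=` isolated Gamma
    & exists2 X : d.+1.-tuple (R^o * V), free X & [set` X] `<=` Gamma].

Definition model_set (Gamma : set (R * V)) (W : set V) : set R :=
  [set gamma.1 | gamma in Gamma `&` snd @^-1` W].

End Euclidean.

Definition bounded_distance_equivalent {R : realType} (L L' : set R) : Prop :=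
  exists K : R, 0 < K /\
    exists chi : R -> R, set_bij L L' chi /\
      forall x, L x -> `|chi x - x| <= K.

(* Main.v *)
Require Import Defs.
From mathcomp Require Import all_boot all_order all_algebra.
From mathcomp Require Import all_classical all_reals all_analysis.
From mathcomp Require Import finmap zify ring lra.
Import Order.TTheory GRing.Theory Num.Theory.
Import numFieldNormedType.Exports.
Local Open Scope classical_set_scope.
Local Open Scope ring_scope.
Set Implicit Arguments.
Unset Strict Implicit.
Unset Printing Implicit Defensive.

(** Call a lattice point [g] a visit to [W] when [g.2] lies in [W], and order the
    visits by their height [g.1]. The model sets are at bounded distance, so
    over every interval of heights the numbers of visits to [W] and to [W']
    differ by a bounded amount, the discrepancy ([cnt_slab_le],
    [discrepancy_cnt]). Read the visits to [W] only as opening brackets, those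
    to [W'] only as closing brackets, and match the brackets as usual
    ([matched]). Sending every visit to [W] to its partner, and every common
    visit to itself, is an injective rule that translates by lattice vectors.

    The point is that partners are found at bounded distance, except near the
    visits to the boundaries of [W] and [W'] ([regular_matched]). Take an
    interval without boundary visits whose discrepancy is the largest possible.
    Its pattern of visits is stable under small perturbations, so by the density
    of the second projections and by compactness it recurs, in the future of any
    visit to [W], after a bounded time ([recurrence]). If an opening bracket were
    still open when the pattern recurs, the interval from this bracket to the end
    of the pattern would have an even larger discrepancy. The same argument with
    time reversed, [W] and [W'] exchanged ([matched_reverse]), shows that closing
    brackets have partners at bounded distance.

    Hence the partner of a point is decided by a finite pattern: which of
    finitely many translates of the point lie in [W] and in [W']. This rule makes
    sense at every point of the space, and it is a bijection from [W] to [W'] at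
    the points that avoid finitely many translates of the two boundaries: it is
    so on the projected lattice, which is dense, and patterns are locally
    constant away from these boundaries ([model_sets_equidecomposable]).
    The pieces are therefore Boolean combinations of translates of [W] and [W'].
    If [W] and [W'] are Riemann measurable, so are the pieces, whose boundaries
    are covered by translates of the given boundaries
    ([riemann_measurable_piece]). If they are polytopes, the simplices of [W] are
    subdivided until no hyperplane supporting a facet of a translate of [W] or
    [W'] cuts any of them ([subdivide_uncuts]); up to null sets, the pieces are
    unions of the resulting simplices ([polytope_piece]). *)

(** * Null sets *)

Section NullSets.
Context {R : realType} {d : nat}.
Notation V := 'rV[R]_d.
Implicit Types (A B : set V) (a b : nat -> V).

Lemma box_volume_ge0 (a b : V) :
  (forall i, a 0 i <= b 0 i) -> 0 <= box_volume a b.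
Proof. by move=> ab; apply: prodr_ge0 => i _; rewrite subr_ge0. Qed.

(** Works with finite partial sums in [R] instead of a series in the extended
    reals; the covers built below are all estimated this way. *)
Lemma lebesgue_nullP A : lebesgue_null A <->
  forall e : R, 0 < e -> exists a b,
    [/\ forall k i, a k 0 i <= b k 0 i,
        A `<=` \bigcup_k box (a k) (b k)
      & forall n, \sum_(k < n) box_volume (a k) (b k) <= e].
Proof.
split=> [A0 e e0|H].
  have /ereal_inf_lt[s [a [b [ab Aab ->]]] se] :
      (lebesgue_outer_measure A < e%:E)%E by rewrite A0 lte_fin.
  exists a, b; split=> // n.
  have vol0 k : (0 <= (box_volume (a k) (b k))%:E)%E.
    by rewrite lee_fin box_volume_ge0.
  have := nneseries_lim_ge (u_ := fun k => (box_volume (a k) (b k))%:E)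
     (P := xpredT) (m := 0%N) n (fun k _ _ => vol0 k).
  by rewrite big_mkord sumEFin => /le_lt_trans/(_ se); rewrite lte_fin => /ltW.
apply/eqP; rewrite eq_le; apply/andP; split.
  apply/lee_addgt0Pr => e e0; rewrite add0e.
  have [a [b [ab Aab le_e]]] := H e e0.
  apply: (@le_trans _ _ (\sum_(0 <= k <oo) (box_volume (a k) (b k))%:E)%E).
    by apply: ereal_inf_lbound; exists a, b.
  apply: lime_le.
    by apply: is_cvg_nneseries => k _ _; rewrite lee_fin box_volume_ge0.
  by apply: nearW => n; rewrite big_mkord sumEFin lee_fin.
apply: le_ereal_inf_tmp => s [a [b [ab _ ->]]].
by apply: nneseries_ge0 => k _ _; rewrite lee_fin box_volume_ge0.
Qed.

Lemma lebesgue_nullS A B : A `<=` B -> lebesgue_null B -> lebesgue_null A.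
Proof.
move=> AB /lebesgue_nullP B0; apply/lebesgue_nullP => e /B0[a [b [ab Bab le_e]]].
by exists a, b; split=> //; apply: subset_trans Bab.
Qed.

(** The covers of [A] and [B] are interleaved, on the even and odd indices. *)
Lemma lebesgue_nullU A B :
  lebesgue_null A -> lebesgue_null B -> lebesgue_null (A `|` B).
Proof.
move=> /lebesgue_nullP A0 /lebesgue_nullP B0; apply/lebesgue_nullP => e e0.
have e2 : 0 < e / 2 by rewrite divr_gt0.
have [a [b [ab Aab le_a]]] := A0 _ e2.
have [a' [b' [ab' Bab' le_b]]] := B0 _ e2.
pose mix (u v : nat -> V) k := if odd k then v k./2 else u k./2.
have mixab k i : mix a a' k 0 i <= mix b b' k 0 i.
  by rewrite /mix; case: ifP.
exists (mix a a'), (mix b b'); split=> //.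
- move=> x [/Aab|/Bab'] [k _ xk].
    by exists k.*2 => //; rewrite /mix odd_double doubleK.
  by exists k.*2.+1 => //; rewrite /mix /= odd_double /= uphalf_double.
- move=> n; apply: (@le_trans _ _
    (\sum_(k < n.*2) box_volume (mix a a' k) (mix b b' k))).
    rewrite -!(big_mkord xpredT (fun k => box_volume (mix a a' k) (mix b b' k))).
    rewrite [leRHS](@big_cat_nat _ _ _ n) //=; last by rewrite -addnn leq_addr.
    by rewrite lerDl sumr_ge0 // => k _; rewrite box_volume_ge0.
  suff -> : \sum_(k < n.*2) box_volume (mix a a' k) (mix b b' k) =
      \sum_(k < n) box_volume (a k) (b k) + \sum_(k < n) box_volume (a' k) (b' k).
    by have := le_a n; have := le_b n; lra.
  elim: n => [|n IH]; first by rewrite !big_ord0 addr0.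
  rewrite doubleS !big_ord_recr /= IH /mix /= odd_double /= uphalf_double doubleK.
  lra.
Qed.

Lemma lebesgue_null_translate A g :
  lebesgue_null A -> lebesgue_null (translate A g).
Proof.
move=> /lebesgue_nullP A0; apply/lebesgue_nullP => e /A0[a [b [ab Aab le_e]]].
exists (fun k => a k + g), (fun k => b k + g); split.
- by move=> k i; rewrite !mxE lerD2r.
- move=> _ [x /Aab[k _ xk] <-]; exists k => // i.
  by rewrite !mxE !lerD2r; exact: xk.
- move=> n; apply: le_trans (le_e n); rewrite le_eqVlt; apply/orP; left.
  apply/eqP; apply: eq_bigr => k _; apply: eq_bigr => i _.
  by rewrite !mxE opprD addrACA subrr addr0.
Qed.

Lemma grid_cell (h y : R) N : 0 <= y -> y <= N.+1%:R * h ->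
  exists k : 'I_N.+1, k%:R * h <= y <= k.+1%:R * h.
Proof.
move=> y0; elim: N => [|N IH] yN.
  by exists ord0; rewrite mul0r y0.
have [/IH[k kP]|Ny] := leP y (N.+1%:R * h).
  by exists (widen_ord (leqnSn _) k).
by exists ord_max; rewrite /= (ltW Ny).
Qed.

Hypothesis d_gt0 : (0 < d)%N.

(** A finite cover is completed to a sequence with copies of the one-point box
    at the origin, which has volume [0] because the dimension is positive. *)
Lemma lebesgue_null_fin A :
  (forall e : R, 0 < e -> exists s : seq (V * V),
    [/\ forall p, p \in s -> forall i, p.1 0 i <= p.2 0 i,
        A `<=` [set x | exists2 p, p \in s & box p.1 p.2 x]
      & \sum_(p <- s) box_volume p.1 p.2 <= e]) -> lebesgue_null A.
Proof.
move=> H; apply/lebesgue_nullP => e /H[s [sab As le_e]].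
have vol00 : box_volume (0 : V) 0 = 0 :> R.
  by rewrite /box_volume (bigD1 (Ordinal d_gt0)) //= subrr mul0r.
have sge k i : (nth (0, 0) s k).1 0 i <= (nth (0, 0) s k).2 0 i.
  have [ks|ks] := ltnP k (size s); first by apply: sab; rewrite mem_nth.
  by rewrite nth_default.
exists (fun k => (nth (0, 0) s k).1), (fun k => (nth (0, 0) s k).2); split=> //.
  by move=> x /As[p /(nthP (0, 0))[k ks <-]] px; exists k.
move=> n; pose F k := box_volume (nth (0, 0) s k).1 (nth (0, 0) s k).2.
have F0 k : 0 <= F k by rewrite /F box_volume_ge0.
apply: le_trans le_e; rewrite (big_nth (0, 0)).
rewrite -(big_mkord xpredT F) -/F.
apply: (@le_trans _ _ (\sum_(0 <= k < n + size s) F k)).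
  rewrite [leRHS](@big_cat_nat _ _ _ n) //= ?leq_addr //.
  by rewrite lerDl sumr_ge0.
rewrite (@big_cat_nat _ _ _ (size s)) ?leq_addl //=.
rewrite [X in _ + X]big_nat_cond [X in _ + X]big1 ?addr0 //.
by move=> k /andP[/andP[sk _] _]; rewrite /F nth_default.
Qed.

Lemma lebesgue_null0 : lebesgue_null (set0 : set V).
Proof.
apply: lebesgue_null_fin => e e0; exists [::]; split=> //.
by rewrite big_nil ltW.
Qed.

Lemma lebesgue_null_bigcup (I : Type) (s : seq I) (F : I -> set V) :
  (forall i, lebesgue_null (F i)) ->
  lebesgue_null (\big[setU/set0]_(i <- s) F i).
Proof.
move=> F0; elim: s => [|i s IH]; rewrite ?big_nil ?big_cons.
  exact: lebesgue_null0.
exact: lebesgue_nullU.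
Qed.

(** Cut the range of the coordinates other than [i0] into [N] intervals. Over
    each of the [N ^ (d - 1)] resulting cells, of side [h = 2 * M / N], the
    coordinate [i0] stays within [S * h] of its value [mid] at the corner of
    the cell. The boxes so obtained have total volume [T / N]. *)
Lemma lebesgue_null_hyperplane (u : 'I_d -> R) (c M : R) (i0 : 'I_d) :
  u i0 != 0 ->
  lebesgue_null [set x : V | \sum_i u i * x 0 i = c /\
                             forall i, - M <= x 0 i <= M].
Proof.
move=> u0; wlog M0 : M / 0 < M => [H|].
  apply: lebesgue_nullS (H (`|M| + 1) _) => [x [xc xM]|].
    split=> // i; have := xM i; have := ler_norm M.
    by move=> ? /andP[? ?]; apply/andP; split; lra.
  by rewrite ltr_wpDl.
pose S := \sum_(j < d.-1) `|u (lift i0 j)| / `|u i0|.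
have S0 : 0 <= S by apply: sumr_ge0 => j _; rewrite divr_ge0.
have un0 : 0 < `|u i0| by rewrite normr_gt0.
apply: lebesgue_null_fin => e e0.
pose T := 2 * S * (2 * M) ^+ d.
have T0 : 0 <= T by rewrite !(mulr_ge0, exprn_ge0) // ltW.
pose N := (Num.truncn (T / e)).+1; pose h := 2 * M / N%:R.
have NT : T / e <= N%:R.
  by rewrite ltW // truncnS_gt.
have h0 : 0 < h by rewrite !divr_gt0 ?mulr_gt0 // ltr0n.
pose corner (k : {ffun 'I_d.-1 -> 'I_N}) j : R := - M + (k j)%:R * h.
pose mid k : R := (c - \sum_(j < d.-1) u (lift i0 j) * corner k j) / u i0.
pose lo k : V := \row_i
  if unlift i0 i is Some j then corner k j else mid k - S * h.
pose hi k : V := \row_i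
  if unlift i0 i is Some j then corner k j + h else mid k + S * h.
exists [seq (lo k, hi k) | k <- enum {ffun 'I_d.-1 -> 'I_N}]; split.
- move=> _ /mapP[k _ ->] i /=; rewrite !mxE.
  have := mulr_ge0 S0 (ltW h0).
  by case: unlift => [j|]; [have := ltW h0|]; lra.
- move=> x [xc xM].
  have cell j : exists k : 'I_N, k%:R * h <= x 0 (lift i0 j) + M <= k.+1%:R * h.
    have /andP[x1 x2] := xM (lift i0 j).
    apply: grid_cell; first by lra.
    by rewrite /h mulrC divfK ?pnatr_eq0 //; lra.
  have [k kP] := choice cell.
  pose kf : {ffun 'I_d.-1 -> 'I_N} := [ffun j => k j].
  exists (lo kf, hi kf); first by apply/mapP; exists kf; rewrite ?mem_enum.
  have cornerP j : corner kf j <= x 0 (lift i0 j) <= corner kf j + h.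
    have := kP j; rewrite /corner ffunE -[(k j).+1]addn1 natrD mulrDl mul1r.
    by move=> /andP[? ?]; apply/andP; split; lra.
  move=> i /=; rewrite !mxE; case: unliftP => [j ->|->]; first exact: cornerP.
  have -> : x 0 i0 = mid kf -
      \sum_(j < d.-1) u (lift i0 j) * (x 0 (lift i0 j) - corner kf j) / u i0.
    rewrite /mid -mulr_suml -mulrBl.
    apply: (mulIf u0); rewrite divfK // -xc (bigD1_ord i0) //= [x 0 i0 * _]mulrC.
    rewrite (eq_bigr _ (fun j _ => mulrBr _ _ _)) sumrB; lra.
  rewrite -ler_distl addrAC subrr add0r normrN.
  apply: le_trans (ler_norm_sum _ _ _) _; rewrite mulr_suml ler_sum // => j _.
  rewrite normrM normfV normrM mulrAC ler_wpM2l ?divr_ge0 //.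
  by have := cornerP j => /andP[? ?]; rewrite ger0_norm; lra.
- rewrite big_map big_enum /=.
  have vol k : box_volume (lo k) (hi k) = 2 * S * h ^+ d.
    rewrite /box_volume (bigD1_ord i0) //= !mxE unlift_none.
    rewrite (eq_bigr (fun=> h)) => [|j _]; last by rewrite !mxE liftK addrC addKr.
    rewrite prodr_const card_ord -[in RHS](prednK d_gt0) exprS; lra.
  under eq_bigr do rewrite vol.
  rewrite sumr_const card_ffun !card_ord -[leLHS]mulr_natr natrX /h expr_div_n.
  have -> : 2 * S * ((2 * M) ^+ d / N%:R ^+ d) * N%:R ^+ d.-1 = T / N%:R.
    rewrite /T -[in N%:R ^+ d](prednK d_gt0) exprS; field.
    by rewrite expf_neq0 pnatr_eq0.
  by rewrite ler_pdivrMr ?ltr0n // mulrC -ler_pdivrMr.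
Qed.
End NullSets.

(** * Affine functions *)

Section BoundedSets.
Context {R : realType} {V : normedModType R}.
Implicit Types A B : set V.

Lemma bounded_setP A :
  bounded_set A <-> exists2 M : R, 0 < M & forall x, A x -> `|x| <= M.
Proof.
split=> [/pinfty_ex_gt0[M M0 AM]|[M M0 AM]]; first by exists M.
exists M; split=> [|r Mr x /AM xM]; first exact: gtr0_real.
exact: le_trans xM (ltW Mr).
Qed.

Lemma bounded_setS A B : A `<=` B -> bounded_set B -> bounded_set A.
Proof.
move=> AB /bounded_setP[M M0 BM]; apply/bounded_setP.
by exists M => // x /AB/BM.
Qed.

Lemma bounded_setU A B :
  bounded_set A -> bounded_set B -> bounded_set (A `|` B).
Proof.
move=> /bounded_setP[M M0 AM] /bounded_setP[N N0 BN]; apply/bounded_setP.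
exists (M + N); first by rewrite addr_gt0.
by move=> x [/AM|/BN] xM; apply: le_trans xM _; rewrite ?lerDl ?lerDr ltW.
Qed.

End BoundedSets.

Section AffineFunctions.
Context {R : realType} {d : nat}.
Notation V := 'rV[R]_d.
Implicit Types (x : V) (l : 'cV[R]_(1 + d)).

(** Homogeneous coordinates turn affine functions on the space into linear
    forms, so that [l] stands for the affine function [aff l]. *)
Definition homog x : 'rV[R]_(1 + d) := row_mx 1%:M x.

Definition aff l x : R := (homog x *m l) 0 0.

Lemma affE l x :
  aff l x = usubmx l 0 0 + \sum_j dsubmx l j 0 * x 0 j.
Proof.
rewrite /aff -{1}(vsubmxK l) mul_row_col mul1mx !mxE; congr (_ + _).
by apply: eq_bigr => j _; rewrite !mxE mulrC.
Qed.

Lemma aff_continuous l : continuous (aff l).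
Proof.
have -> : aff l =
    (fun x => usubmx l 0 0 + \sum_j dsubmx l j 0 * x 0 j) :> (V -> R).
  by apply/funext => x; rewrite affE.
suff sumC (s : seq 'I_d) :
    continuous (fun x : V => \sum_(j <- s) dsubmx l j 0 * x 0 j : R).
  by move=> x; apply: continuousD; [exact: cst_continuous|exact: sumC].
elim: s => [|j s IH] x.
  rewrite (_ : (fun _ => _) = fun=> 0) ?(funext (fun=> big_nil _ _ _ _)) //.
  exact: cst_continuous.
rewrite (_ : (fun _ => _) = (fun y : V => dsubmx l j 0 * y 0 j +
  \sum_(k <- s) dsubmx l k 0 * y 0 k)); last by apply/funext => y; rewrite big_cons.
pose f (y : V) := dsubmx l j 0 * y 0 j.
pose g (y : V) := \sum_(k <- s) dsubmx l k 0 * y 0 k.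
apply: (@continuousD _ _ _ f g x); last exact: IH.
by apply: continuousM; [exact: cst_continuous|exact: coord_continuous].
Qed.

(** The argument moves away from [y] on the line through [x] and [y]. *)
Lemma aff_line l (x y : V) (e : R) :
  aff l (x + e *: (x - y)) = (1 + e) * aff l x - e * aff l y.
Proof.
rewrite /aff.
have -> : homog (x + e *: (x - y)) = (1 + e) *: homog x - e *: homog y.
  rewrite /homog !scale_row_mx opp_row_mx add_row_mx.
  congr row_mx; last by rewrite scalerBr scalerDl scale1r addrA.
  by rewrite -scalerBl addrK scale1r.
by rewrite mulmxBl -!scalemxAl !mxE.
Qed.

Lemma norm_coord_le x j : `|x 0 j| <= `|x|.
Proof.
rewrite [leRHS]/Num.norm /= mx_normrE; apply/bigmax_geP; right => /=.
by exists (0, j).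
Qed.


Lemma lebesgue_null_affine_zeros (d_gt0 : (0 < d)%N) l (x0 : V) (M : R) :
  aff l x0 != 0 -> lebesgue_null [set x | aff l x = 0 /\ `|x| <= M].
Proof.
move=> lx0; have [[j lj]|l0] := pselect (exists j, dsubmx l j 0 != 0).
  apply: lebesgue_nullS (lebesgue_null_hyperplane d_gt0
    (- usubmx l 0 0) M (u := fun j => dsubmx l j 0) lj).
  move=> x [lx xM]; split.
    by move: lx; rewrite affE addrC => /eqP; rewrite addr_eq0 => /eqP.
  by move=> i; rewrite -ler_norml; apply: le_trans (norm_coord_le x i) xM.
apply: lebesgue_nullS (lebesgue_null0 d_gt0) => x [lx _].
suff lxE y : aff l y = usubmx l 0 0 by move: lx0; rewrite lxE -(lxE x) lx eqxx.
rewrite affE big1 ?addr0 // => j _.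
have [->|lj] := eqVneq (dsubmx l j 0) 0; first by rewrite mul0r.
by case: l0; exists j.
Qed.

End AffineFunctions.

(** * Simplices and barycentric coordinates *)

Section Simplices.
Context {R : realType} {d : nat}.
Notation V := 'rV[R]_d.
Notation vertices := 'M[R]_(1 + d, d).
Implicit Types (x : V) (A B : vertices) (l : 'cV[R]_(1 + d)) (t : 'rV[R]_(1 + d)).

(** The vertices of a simplex are the rows of [A]; they are affinely independent
    exactly when their homogeneous coordinates form an invertible matrix. *)
Definition hmx A : 'M[R]_(1 + d) := row_mx (const_mx 1) A.

Definition nondegenerate A := hmx A \in unitmx.

Definition bary A x : 'rV[R]_(1 + d) := homog x *m invmx (hmx A).

Definition facet A i : 'cV[R]_(1 + d) := col i (invmx (hmx A)).

(** The simplex spanned by the rows of [A] and its interior, cut out by the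
    facet inequalities; see [convex_hullE] and [interior_hull]. *)
Definition hull A : set V := [set x | forall i, 0 <= bary A x 0 i].

Definition ohull A : set V := [set x | forall i, 0 < bary A x 0 i].

Lemma bary_aff A x i : bary A x 0 i = aff (facet A i) x.
Proof. by rewrite /bary /aff !mxE; apply: eq_bigr => j _; rewrite !mxE. Qed.

Lemma homog_bary A x : nondegenerate A -> homog x = bary A x *m hmx A.
Proof. by move=> uA; rewrite mulmxKV. Qed.

Lemma mulmx_const1 t : t *m (const_mx 1 : 'cV[R]_(1 + d)) = (\sum_i t 0 i)%:M.
Proof.
by apply/rowP => i; rewrite !mxE ord1; apply: eq_bigr => j _; rewrite !mxE mulr1.
Qed.

Lemma sum_bary A x : nondegenerate A -> \sum_i bary A x 0 i = 1.
Proof.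
move=> /(homog_bary x); rewrite /hmx mul_mx_row mulmx_const1 => /eq_row_mx[+ _].
by move=> /matrixP/(_ 0 0); rewrite !mxE.
Qed.

Lemma bary_comb A x : nondegenerate A -> x = bary A x *m A.
Proof. by move=> /(homog_bary x); rewrite /hmx mul_mx_row => /eq_row_mx[_]. Qed.

Lemma comb_bary A t : nondegenerate A -> \sum_i t 0 i = 1 -> bary A (t *m A) = t.
Proof.
move=> uA t1; rewrite /bary -[RHS](mulmxK uA); congr (_ *m _).
by rewrite /hmx mul_mx_row mulmx_const1 t1.
Qed.

Lemma bary_vertex A i : nondegenerate A -> bary A (row i A) = delta_mx 0 i.
Proof.
move=> uA; rewrite rowE comb_bary // (bigD1 i) //= mxE !eqxx big1 ?addr0 //.
by move=> j /negPf ji; rewrite mxE ji andbF.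
Qed.

Lemma aff_bary A l x : nondegenerate A ->
  aff l x = \sum_i bary A x 0 i * aff l (row i A).
Proof.
move=> uA; rewrite /aff (homog_bary x uA) -mulmxA mxE; apply: eq_bigr => i _.
congr (_ * _); rewrite -[in RHS](mul1mx l) mulmxA !mxE; apply: eq_bigr => j _.
congr (_ * _); rewrite mulmx1 /homog /hmx.
by case: (split_ordP j) => k ->; rewrite ?row_mxEl ?row_mxEr !mxE // ord1.
Qed.

Lemma nondegenerateP A :
  affinely_independent (fun i => row i A) <-> nondegenerate A.
Proof.
have diffE (k : 'I_d -> R) :
    \sum_i k i *: (row (lift ord0 i) A - row (0 : 'I_(1 + d)) A) =
    \sum_i k i *: row (lift ord0 i) A - (\sum_i k i) *: row (0 : 'I_(1 + d)) A.
  by rewrite scaler_suml -sumrB; apply: eq_bigr => i _; rewrite scalerBr.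
rewrite /affinely_independent; split=> [/freeP freeA|uA].
  rewrite /nondegenerate -row_free_unit; apply: inj_row_free => t.
  rewrite /hmx mul_mx_row mulmx_const1 -row_mx0 => /eq_row_mx[t0 tA].
  have {}t0 : \sum_i t 0 i = 0 by move/matrixP/(_ 0 0): t0; rewrite !mxE.
  move: tA; rewrite mulmx_sum_row; rewrite !big_ord_recl in t0 * => tA.
  have tl i : t 0 (lift ord0 i) = 0.
    apply: (freeA (fun i => t 0 (lift ord0 i))).
    under eq_bigr do rewrite -tnth_nth tnth_mktuple.
    rewrite diffE; move/eqP: t0; rewrite addrC addr_eq0 => /eqP ->.
    by rewrite scaleNr opprK addrC.
  apply/rowP => i; rewrite row_mx0 mxE.
  case: (unliftP ord0 i) => [j|] ->; first exact: tl.
  by move: t0; rewrite big1 ?addr0.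
apply/freeP => k; under eq_bigr do rewrite -tnth_nth tnth_mktuple.
rewrite diffE => /eqP; rewrite subr_eq0 => /eqP kA i.
pose t : 'rV[R]_(1 + d) :=
  \row_i if unlift ord0 i is Some j then k j else - \sum_j k j.
have t0 : t 0 0 = - \sum_j k j by rewrite mxE unlift_none.
have tl j : t 0 (lift ord0 j) = k j by rewrite mxE liftK.
suff t_eq0 : t = 0 by rewrite -tl t_eq0 mxE.
apply: (can_inj (mulmxK uA)); rewrite mul0mx /hmx mul_mx_row mulmx_const1.
have -> : \sum_i t 0 i = 0.
  by rewrite big_ord_recl t0 (eq_bigr _ (fun j _ => tl j)) addNr.
have -> : t *m A = 0.
  rewrite mulmx_sum_row big_ord_recl t0.
  rewrite (eq_bigr (fun j => k j *: row (lift ord0 j) A)) => [|j _].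
    2: by congr (_ *: _); exact: tl.
  by rewrite kA scaleNr addNr.
by rewrite raddf0 row_mx0.
Qed.

Lemma convex_hullE A : nondegenerate A ->
  convex_hull (fun i : 'I_d.+1 => row (i : 'I_(1 + d)) A) = hull A.
Proof.
move=> uA; apply/seteqP; split=> [_ [t [t0 t1 ->]]|x xA].
  pose r : 'rV[R]_(1 + d) := \row_i t i.
  have -> : \sum_i t i *: row (i : 'I_(1 + d)) A = r *m A.
    by rewrite mulmx_sum_row; apply: eq_bigr => i _; rewrite mxE.
  move=> i; rewrite comb_bary ?mxE //.
  by rewrite -[RHS]t1; apply: eq_bigr => j _; rewrite mxE.
exists (fun i => bary A x 0 i); split=> //; first exact: sum_bary.
by rewrite {1}(bary_comb x uA) mulmx_sum_row.
Qed.

Lemma simplexP (S : set V) :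
  simplex S <-> exists2 A, nondegenerate A & S = hull A.
Proof.
split=> [[v [v_free ->]]|[A uA ->]].
  pose A : vertices := \matrix_i v i.
  have vE : v = (fun i : 'I_d.+1 => row (i : 'I_(1 + d)) A).
    by apply/funext => i; rewrite rowK.
  have uA : nondegenerate A by apply/nondegenerateP; rewrite -vE.
  by exists A => //; rewrite vE convex_hullE.
exists (fun i : 'I_d.+1 => row (i : 'I_(1 + d)) A); split.
  by apply/nondegenerateP.
by rewrite convex_hullE.
Qed.

Lemma closed_hull A : closed (hull A).
Proof.
have -> : hull A = \bigcap_i (aff (facet A i) @^-1` [set y | 0 <= y]).
  by apply/seteqP; split=> x xA i; [move=> _|]; have := xA i; rewrite /= bary_aff; exact.
apply: closed_bigI => i _; apply: preimage_closed; last exact: closed_ge.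
by move=> x _; exact: aff_continuous.
Qed.

Lemma bounded_hull A : nondegenerate A -> bounded_set (hull A).
Proof.
move=> uA; apply/bounded_setP; exists (1 + \sum_i `|row i A|).
  by rewrite ltr_pwDl // sumr_ge0.
move=> x xA; rewrite {1}(bary_comb x uA) mulmx_sum_row.
apply: le_trans (ler_norm_sum _ _ _) _; apply: (@le_trans _ _ (\sum_i `|row i A|)).
  apply: ler_sum => i _; rewrite normrZ (ger0_norm (xA i)) ler_piMl //.
  by rewrite -(sum_bary x uA) (bigD1 i) //= lerDl sumr_ge0.
by rewrite lerDr.
Qed.

(** A point of the hull with a vanishing barycentric coordinate leaves the hull
    when pushed away from the corresponding vertex. *)
Lemma interior_hull A : nondegenerate A -> interior (hull A) = ohull A.
Proof.
move=> uA; apply/seteqP; split=> [x xA i|].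
  rewrite lt_neqAle (interior_subset xA) andbT; apply/eqP => xi0.
  move: xA => /nbhs_ballP[e /= e0]; rewrite -ball_normE => xA.
  pose n := `|x - row i A| + 1; have n0 : 0 < n by rewrite ltr_wpDl.
  have h0 : 0 < e / 2 / n by rewrite !divr_gt0.
  have : hull A (x + (e / 2 / n) *: (x - row i A)).
    apply: xA; rewrite /= opprD addNKr normrN normrZ gtr0_norm // mulrAC.
    rewrite ltr_pdivrMr // /n mulrDr mulr1.
    by have := mulr_ge0 (ltW e0) (normr_ge0 (x - row i A)); lra.
  move=> /(_ i); rewrite bary_aff aff_line -!bary_aff -xi0 bary_vertex //.
  by rewrite mxE !eqxx mulr0 mulr1 sub0r oppr_ge0 leNgt h0.
move=> x xA; have pos i : \forall y \near x, 0 < aff (facet A i) y.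
  apply: open_nbhs_nbhs; split; last by rewrite /= -bary_aff.
  apply: (@open_comp _ _ (aff (facet A i)) [set z | 0 < z]); last exact: open_gt.
  by move=> y _; exact: aff_continuous.
have sub : [set y | forall i, 0 < aff (facet A i) y] `<=` hull A.
  by move=> y ypos i; rewrite bary_aff ltW.
exact: (filterS sub (filter_forall (nbhs_filter x) pos)).
Qed.

Lemma ohull_sub A : ohull A `<=` hull A.
Proof. by move=> x xA i; exact: ltW. Qed.

Lemma ohull_mono A B : nondegenerate A -> nondegenerate B ->
  hull A `<=` hull B -> ohull A `<=` ohull B.
Proof. by move=> uA uB /interiorS; rewrite !interior_hull. Qed.

Lemma boundary_hull_null (d_gt0 : (0 < d)%N) A :
  nondegenerate A -> lebesgue_null (boundary (hull A)).
Proof.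
move=> uA; have /bounded_setP[M M0 AM] := bounded_hull uA.
apply: lebesgue_nullS (lebesgue_null_bigcup d_gt0 (index_enum 'I_(1 + d))
  (F := fun i => [set x | aff (facet A i) x = 0 /\ `|x| <= M]) _); last first.
  move=> i; apply: (lebesgue_null_affine_zeros d_gt0 (x0 := row i A)).
  by rewrite -bary_aff bary_vertex // mxE !eqxx oner_eq0.
move=> x []; rewrite -(iffLR (closure_id _) (@closed_hull A)) interior_hull //.
move=> xA xoA; have [i xi] : exists i, bary A x 0 i = 0.
  apply: contrapT => /forallNP nx; apply: xoA => i.
  by rewrite lt_neqAle xA andbT; apply/eqP => xi; apply: (nx i).
by rewrite -bigcup_seq; exists i; rewrite /= ?mem_index_enum // -bary_aff xi AM.
Qed.

End Simplices.

(** * Subdivision of simplices along hyperplanes *)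

Section Subdivision.
Context {R : realType} {d : nat}.
Notation V := 'rV[R]_d.
Notation vertices := 'M[R]_(1 + d, d).
Implicit Types (x : V) (A B : vertices) (l : 'cV[R]_(1 + d)) (s : seq vertices).
Implicit Types (i j k : 'I_(1 + d)) (a b : R) (P : set V).

Lemma aff_vertex A l k : aff l (row k A) = (hmx A *m l) k 0.
Proof.
rewrite /aff.
have -> : homog (row k A) = row k (hmx A).
  apply/rowP => j; rewrite /homog /hmx [RHS]mxE.
  by case: (split_ordP j) => m ->; rewrite ?row_mxEl ?row_mxEr !mxE // ord1.
by rewrite -row_mul mxE.
Qed.

Lemma aff_pos_hull A l : nondegenerate A ->
  (forall k, 0 <= aff l (row k A)) -> forall x, hull A x -> 0 <= aff l x.
Proof.
move=> uA lA x xA; rewrite (aff_bary l x uA).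
by apply: sumr_ge0 => k _; rewrite mulr_ge0.
Qed.

Lemma affN l x : aff (- l) x = - aff l x.
Proof. by rewrite /aff mulmxN mxE. Qed.

Lemma aff_neg_hull A l : nondegenerate A ->
  (forall k, aff l (row k A) <= 0) -> forall x, hull A x -> aff l x <= 0.
Proof.
move=> uA lA x xA; rewrite -oppr_ge0 -affN.
by apply: (aff_pos_hull uA _ xA) => k; rewrite affN oppr_ge0.
Qed.

(** The identity matrix with its row [i] replaced by [a e_i + b e_j]: acting on
    the left, it replaces the vertex [i] of a simplex by a point of the edge
    joining the vertices [i] and [j]. *)
Definition bisect_mx i j a b : 'M[R]_(1 + d) :=
  1%:M + (delta_mx i 0 : 'cV_(1 + d)) *m
         ((a - 1) *: delta_mx 0 i + b *: delta_mx 0 j).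

Definition bisect i j a b A : vertices := bisect_mx i j a b *m A.

Lemma mul_bisect_mx i j a b (t : 'rV[R]_(1 + d)) k :
  (t *m bisect_mx i j a b) 0 k =
  t 0 k + t 0 i * ((a - 1) * (k == i)%:R + b * (k == j)%:R).
Proof.
rewrite /bisect_mx mulmxDr mulmx1 mulmxA -colE mxE; congr (_ + _).
by rewrite mxE big_ord1 !mxE !eqxx.
Qed.

Lemma bisect_mx_mul i j a b (c : 'cV[R]_(1 + d)) k :
  (bisect_mx i j a b *m c) k 0 =
  c k 0 + (k == i)%:R * ((a - 1) * c i 0 + b * c j 0).
Proof.
rewrite /bisect_mx mulmxDl mul1mx -mulmxA mxE; congr (_ + _).
rewrite mulmxDl -!scalemxAl -!rowE mxE big_ord1 !mxE andbT.
by [].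
Qed.

Lemma hmx_bisect i j a b A : a + b = 1 ->
  hmx (bisect i j a b A) = bisect_mx i j a b *m hmx A.
Proof.
move=> ab; rewrite /hmx mul_mx_row; congr row_mx.
apply/colP => k; rewrite bisect_mx_mul !mxE !mulr1.
have -> : a - 1 + b = 0 by lra.
by rewrite mulr0 addr0.
Qed.

Lemma bisect_nondegenerate i j a b A : i != j -> 0 < a -> a + b = 1 ->
  nondegenerate A -> nondegenerate (bisect i j a b A).
Proof.
move=> /negPf ij a0 ab uA; rewrite /nondegenerate hmx_bisect // unitmx_mul.
apply/andP; split => //; rewrite -row_free_unit; apply: inj_row_free => t tE.
have tk k := mul_bisect_mx i j a b t k; rewrite tE in tk.
have ti : t 0 i = 0.
  move: (tk i); rewrite mxE eqxx ij mulr0 addr0 mulr1 => ta.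
  have /eqP : a * t 0 i = 0 by lra.
  by rewrite mulf_eq0 (gt_eqF a0) => /eqP.
by apply/rowP => k; move: (tk k); rewrite !mxE ti mul0r addr0.
Qed.

Lemma bary_bisect i j a b A x k : i != j -> 0 < a -> a + b = 1 ->
  nondegenerate A -> let B := bisect i j a b A in
  bary A x 0 k =
  bary B x 0 k + bary B x 0 i * ((a - 1) * (k == i)%:R + b * (k == j)%:R).
Proof.
move=> ij a0 ab uA B.
suff -> : bary A x = bary B x *m bisect_mx i j a b by exact: mul_bisect_mx.
apply: (can_inj (mulmxK uA)); rewrite -homog_bary // -mulmxA -hmx_bisect //.
by rewrite -homog_bary // bisect_nondegenerate.
Qed.

(** A polytope presented by a list of simplices, whose open hulls are used
    instead of topological interiors. *)
Definition simplicial s P : Prop :=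
  [/\ {in s, forall A, nondegenerate A},
      pairwise (fun A B => `[< ohull A `&` ohull B = set0 >]) s
    & P = [set x | exists2 A, A \in s & hull A x]].

Lemma simplicial1 A : nondegenerate A -> simplicial [:: A] (hull A).
Proof.
move=> uA; split=> //; first by move=> B; rewrite inE => /eqP ->.
apply/seteqP; split=> [x xA|x [B]]; first by exists A; rewrite ?inE.
by rewrite inE => /eqP ->.
Qed.

Lemma simplicial_cat s1 P1 s2 P2 : simplicial s1 P1 -> simplicial s2 P2 ->
  {in s1 & s2, forall A B, ohull A `&` ohull B = set0} ->
  simplicial (s1 ++ s2) (P1 `|` P2).
Proof.
move=> [u1 d1 ->] [u2 d2 ->] d12; split.
- by move=> A; rewrite mem_cat => /orP[/u1|/u2].
- rewrite pairwise_cat d1 d2 !andbT; apply/allrelP => A B sA sB.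
  by apply/asboolP; exact: d12.
- apply/seteqP; split=> x [].
  + by case=> A sA xA; exists A; rewrite ?mem_cat ?sA.
  + by case=> A sA xA; exists A; rewrite ?mem_cat ?sA ?orbT.
  + by move=> A; rewrite mem_cat => /orP[] sA xA; [left|right]; exists A.
Qed.

Lemma simplicial_sub s P A : simplicial s P -> A \in s -> hull A `<=` P.
Proof. by move=> [_ _ ->] sA x xA; exists A. Qed.

(** With barycentric coordinates [t], the new edge point splits the simplex
    according to the sign of [a * t_j - b * t_i]. *)
Lemma simplicial_bisect i j a b A : i != j -> 0 < a -> 0 < b -> a + b = 1 ->
  nondegenerate A ->
  simplicial [:: bisect i j a b A; bisect j i b a A] (hull A).
Proof.
move=> ij a0 b0 ab uA; set B := bisect i j a b A; set C := bisect j i b a A.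
have ji : j != i by rewrite eq_sym.
have ba : b + a = 1 by rewrite addrC.
have uB : nondegenerate B by exact: bisect_nondegenerate.
have uC : nondegenerate C by exact: bisect_nondegenerate.
have BE x k : bary A x 0 k = _ := bary_bisect x k ij a0 ab uA.
have CE x k : bary A x 0 k = _ := bary_bisect x k ji b0 ba uA.
have Bi x : bary A x 0 i = a * bary B x 0 i.
  by rewrite BE eqxx (negPf ij) /=; lra.
have Bj x : bary A x 0 j = bary B x 0 j + b * bary B x 0 i.
  by rewrite BE eqxx (negPf ji) /=; lra.
have Cj x : bary A x 0 j = b * bary C x 0 j.
  by rewrite CE eqxx (negPf ji) /=; lra.
have Ci x : bary A x 0 i = bary C x 0 i + a * bary C x 0 j.
  by rewrite CE eqxx (negPf ij) /=; lra.
have Bk x k : k != i -> k != j -> bary B x 0 k = bary A x 0 k.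
  by rewrite BE => /negPf -> /negPf -> /=; lra.
have Ck x k : k != i -> k != j -> bary C x 0 k = bary A x 0 k.
  by rewrite CE => /negPf -> /negPf -> /=; lra.
have hullE : hull A = hull B `|` hull C.
  apply/seteqP; split=> [x xA|x [xB|xC] k].
  - have [ba_t|ab_t] := leP (b * bary A x 0 i) (a * bary A x 0 j).
      left=> k; have [->|ki] := eqVneq k i.
        by have := xA i; rewrite Bi pmulr_rge0.
      have [->|kj] := eqVneq k j; last by rewrite Bk.
      by move: ba_t; rewrite Bi Bj -(pmulr_rge0 _ a0); lra.
    right=> k; have [->|kj] := eqVneq k j.
      by have := xA j; rewrite Cj pmulr_rge0.
    have [->|ki] := eqVneq k i; last by rewrite Ck.
    by move: ab_t; rewrite Ci Cj -(pmulr_rge0 _ b0); lra.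
  - have [->|ki] := eqVneq k i; first by rewrite Bi mulr_ge0 // ltW.
    have [->|kj] := eqVneq k j; last by rewrite -Bk.
    by rewrite Bj addr_ge0 // mulr_ge0 // ltW.
  - have [->|kj] := eqVneq k j; first by rewrite Cj mulr_ge0 // ltW.
    have [->|ki] := eqVneq k i; last by rewrite -Ck.
    by rewrite Ci addr_ge0 // mulr_ge0 // ltW.
rewrite hullE; apply: (@simplicial_cat [:: B] _ [:: C]); try exact: simplicial1.
move=> _ _ /[!inE] /eqP -> /eqP ->; apply/seteqP; split=> // x [xB xC].
have : 0 < a * bary B x 0 j by rewrite mulr_gt0.
have : 0 < b * bary C x 0 i by rewrite mulr_gt0.
by have := Bi x; have := Bj x; have := Ci x; have := Cj x; nra.
Qed.

(** Subdividing each simplex separately keeps the open hulls disjoint, since the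
    parts of a simplex have their open hulls inside its own. *)
Lemma simplicial_refine s P (Q : vertices -> Prop) : simplicial s P ->
  {in s, forall A, exists2 s', simplicial s' (hull A) & {in s', forall B, Q B}} ->
  exists s', [/\ simplicial s' P,
    {in s', forall B, exists2 A, A \in s & hull B `<=` hull A}
    & {in s', forall B, Q B}].
Proof.
elim: s P => [|A s IH] P [u dj ->] HQ.
  by exists [::]; split=> //; split.
have uA : nondegenerate A by apply: u; rewrite inE eqxx.
have us : {in s, forall A, nondegenerate A}.
  by move=> B sB; apply: u; rewrite inE sB orbT.
move: dj; rewrite /= => /andP[/allP djA djs].
have [s2 [S2 fine2 Q2]] : exists s', [/\
    simplicial s' [set x | exists2 A, A \in s & hull A x],
    {in s', forall B, exists2 A, A \in s & hull B `<=` hull A}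
    & {in s', forall B, Q B}].
  by apply: IH => // B sB; apply: HQ; rewrite inE sB orbT.
have [s1 S1 Q1] := HQ A (mem_head _ _).
exists (s1 ++ s2); split.
- have -> : [set x | exists2 B, B \in A :: s & hull B x] =
      hull A `|` [set x | exists2 B, B \in s & hull B x].
    apply/seteqP; split=> x.
      case=> B; rewrite inE => /orP[/eqP ->|sB] xB; first by left.
      by right; exists B.
    case=> [xA|[B sB xB]]; first by exists A; rewrite ?mem_head.
    by exists B; rewrite // inE sB orbT.
  apply: simplicial_cat => // B C sB sC.
  have [u1 _ _] := S1; have [u2 _ _] := S2; have [A' sA' CA'] := fine2 C sC.
  have /asboolP AA' := djA A' sA'.
  rewrite -subset0 -AA'; apply: setISS; apply: ohull_mono => //.
  + exact: u1.
  + exact: simplicial_sub S1 sB.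
  + exact: u2.
  + exact: us.
- move=> B; rewrite mem_cat => /orP[/(simplicial_sub S1) BA|/fine2[A' sA' BA']].
    by exists A; rewrite ?mem_head.
  by exists A'; rewrite // inE sA' orbT.
- by move=> B; rewrite mem_cat => /orP[/Q1|/Q2].
Qed.

Definition uncut l A :=
  (forall x, hull A x -> 0 <= aff l x) \/ (forall x, hull A x -> aff l x <= 0).

Lemma aff_bisect i j a b A l k : a + b = 1 ->
  aff l (row k (bisect i j a b A)) =
  if k == i then a * aff l (row i A) + b * aff l (row j A) else aff l (row k A).
Proof.
move=> ab; rewrite !aff_vertex hmx_bisect // -mulmxA bisect_mx_mul.
by case: eqP => [->|_] /=; lra.
Qed.

(** As long as [aff l] takes both signs on the vertices, bisect an edge joining
    vertices of opposite signs at the zero of [aff l] on it: in both halves one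
    vertex with a nonzero value is replaced by one with value [0]. *)
Lemma subdivide_uncut l A : nondegenerate A ->
  exists2 s, simplicial s (hull A) & {in s, forall B, uncut l B}.
Proof.
move: {2}#|_|.+1 (ltnSn #|[pred k | aff l (row k A) != 0]|) => n.
elim: n A => [//|n IH] A; rewrite ltnS => An uA.
have [[i [j [li lj]]]|H] := pselect (exists i j,
    0 < aff l (row i A) /\ aff l (row j A) < 0); last first.
  exists [:: A]; first exact: simplicial1.
  move=> B; rewrite inE => /eqP ->.
  have [[i li]|ln] := pselect (exists i, 0 < aff l (row i A)).
    left; apply: aff_pos_hull => // k; rewrite leNgt; apply/negP => lk.
    by apply: H; exists i, k.
  right; apply: aff_neg_hull => // k; rewrite leNgt; apply/negP => lk.
  by apply: ln; exists k.
have ij : i != j.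
  by apply/negP => /eqP ij; move: li; rewrite ij => /lt_trans/(_ lj); rewrite ltxx.
pose D := aff l (row i A) - aff l (row j A).
have D0 : 0 < D by rewrite subr_gt0 (lt_trans lj).
pose a := - aff l (row j A) / D; pose b := aff l (row i A) / D.
have a0 : 0 < a by rewrite divr_gt0 // oppr_gt0.
have b0 : 0 < b by rewrite divr_gt0.
have ab : a + b = 1 by rewrite /a /b -mulrDl addrC divff // gt_eqF.
have lab : a * aff l (row i A) + b * aff l (row j A) = 0 by rewrite /a /b; ring.
have cut (m p : 'I_(1 + d)) (x y : R) : m != p -> 0 < x -> x + y = 1 ->
    aff l (row m A) != 0 -> x * aff l (row m A) + y * aff l (row p A) = 0 ->
    exists2 s, simplicial s (hull (bisect m p x y A)) & {in s, forall B, uncut l B}.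
  move=> mp x0 xy lm l0; apply: IH; last exact: bisect_nondegenerate.
  apply: leq_trans An; rewrite [leqRHS](cardD1 m) inE lm ltnS.
  apply: subset_leq_card; apply/fintype.subsetP => k; rewrite !inE aff_bisect //.
  by case: ifP => [/eqP ->|_] //; rewrite l0 eqxx.
have [|s [S _ Qs]] := simplicial_refine (Q := uncut l)
  (simplicial_bisect ij a0 b0 ab uA); last by exists s.
move=> B; rewrite !inE => /orP[] /eqP ->; apply: cut => //.
- by rewrite gt_eqF.
- by rewrite eq_sym.
- by rewrite addrC.
- by rewrite lt_eqF.
- by rewrite addrC.
Qed.

Lemma subdivide_uncuts (ls : seq 'cV[R]_(1 + d)) s P : simplicial s P ->
  exists2 s', simplicial s' P & {in s' & ls, forall B l, uncut l B}.
Proof.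
elim: ls => [|l ls IH] S; first by exists s.
have [s1 S1 Q1] := IH S; have [u1 _ _] := S1.
have [s2 [S2 fine Q2]] := simplicial_refine S1
  (fun A sA => subdivide_uncut l (u1 A sA)).
exists s2 => // B m sB; rewrite inE => /orP[/eqP ->|lsm]; first exact: Q2.
have [A sA BA] := fine B sB.
by have [mA|mA] := Q1 A m sA lsm; [left|right] => x /BA/mA.
Qed.

(** If a nonnegative affine function vanishes at a point with positive
    barycentric coordinates, it vanishes at all vertices, hence everywhere. *)
Lemma uncut_sign l A x0 : nondegenerate A -> aff l x0 != 0 -> uncut l A ->
  (forall x, ohull A x -> 0 < aff l x) \/ (forall x, ohull A x -> aff l x < 0).
Proof.
have pos (m : 'cV[R]_(1 + d)) : nondegenerate A -> aff m x0 != 0 ->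
    (forall x, hull A x -> 0 <= aff m x) -> forall x, ohull A x -> 0 < aff m x.
  move=> uA mx0 mA x xA; have mv k : 0 <= aff m (row k A).
    by apply: mA => i; rewrite bary_vertex // mxE; case: andb.
  rewrite lt_neqAle mA ?andbT; last exact: ohull_sub.
  apply: contraNN mx0; rewrite eq_sym (aff_bary m x uA) psumr_eq0 => [/allP m0|k _];
    last by rewrite mulr_ge0 // ltW.
  rewrite (aff_bary m x0 uA) big1 // => k _.
  have := m0 k (mem_index_enum k); rewrite mulf_eq0 (gt_eqF (xA k)) /= => /eqP ->.
  by rewrite mulr0.
move=> uA lx0 [lA|lA]; [left; exact: pos|right=> x xA].
rewrite -oppr_gt0 -affN; apply: pos => //; first by rewrite affN oppr_eq0.
by move=> y /lA; rewrite affN oppr_ge0.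
Qed.

End Subdivision.

(** * Patterns and pieces *)

Section Patterns.
Context {R : realType} {d : nat}.
Notation V := 'rV[R]_d.
Implicit Types (x y g h : V) (H : seq V) (A B P W E : set V).

(** The pattern of [x] records which translates [x + h], [h] in the finite list
    [H], lie in [W] and in [W']. The pieces of the decomposition are unions of
    classes of points with the same pattern. *)
Definition same_pattern W (W' : set V) H x y := forall h, h \in H ->
  (W (x + h) <-> W (y + h)) /\ (W' (x + h) <-> W' (y + h)).

Definition pattern_determined W (W' : set V) H P :=
  forall x y, same_pattern W W' H x y -> P x -> P y.

Definition pattern_boundary W (W' : set V) H : set V :=
  [set x | exists2 h, h \in H & boundary W (x + h) \/ boundary W' (x + h)].

Lemma near_not_boundary A x : ~ boundary A x -> \forall y \near x, A y <-> A x.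
Proof.
move=> bx; have [iAx|niAx] := pselect (interior A x).
  have := iAx; apply: filterS => y Ay; split=> // _; exact: nbhs_singleton iAx.
have ncx : ~ closure A x by move=> cx; apply: bx.
have : nbhs x (~` closure A).
  apply: open_nbhs_nbhs; split=> //; apply: closed_openC; exact: closed_closure.
apply: filterS => y ncy; split=> [/subset_closure //|/subset_closure //].
Qed.

(** Membership in a set is locally constant off its boundary, so the pattern is
    locally constant off finitely many translates of boundaries. *)
Lemma near_same_pattern W W' H x : ~ pattern_boundary W W' H x ->
  \forall y \near x, same_pattern W W' H y x.
Proof.
elim: H => [|h H IH] bx; first by apply: (@filterE _ (nbhs x)) => y h.
have addh : {for x, continuous (fun y => y + h)}.
  by apply: continuousD; [exact: cvg_id|exact: cst_continuous].
have {}IH : \forall y \near x, same_pattern W W' H y x.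
  apply: IH => -[k Hk bk]; apply: bx; exists k => //.
  by rewrite inE Hk orbT.
have W1 : \forall y \near x, W (y + h) <-> W (x + h).
  have bh : ~ boundary W (x + h).
    by move=> bh; apply: bx; exists h; [rewrite mem_head|left].
  exact: (addh _ (near_not_boundary bh)).
have W2 : \forall y \near x, W' (y + h) <-> W' (x + h).
  have bh : ~ boundary W' (x + h).
    by move=> bh; apply: bx; exists h; [rewrite mem_head|right].
  exact: (addh _ (near_not_boundary bh)).
near=> y => k; rewrite inE => /orP[/eqP ->|Hk].
  by split; [near: y; exact: W1|near: y; exact: W2].
by move: k Hk; near: y; exact: IH.
Unshelve. all: by end_near. Qed.

Lemma boundary_pattern_determined W W' H P : pattern_determined W W' H P ->
  boundary P `<=` pattern_boundary W W' H.
Proof.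
move=> HP x [cPx niPx]; apply: contrapT => bx; apply: niPx.
have nx := near_same_pattern bx.
have [y [Py yx]] := cPx _ nx.
have Px : P x by exact: HP yx Py.
have := nx; apply: filterS => z zx; apply: HP Px => h Hh.
by have [? ?] := zx h Hh; split; split=> ?; intuition.
Qed.

Lemma pattern_boundary_null (d_gt0 : (0 < d)%N) W W' H :
  lebesgue_null (boundary W) -> lebesgue_null (boundary W') ->
  lebesgue_null (pattern_boundary W W' H).
Proof.
move=> W0 W'0; apply: lebesgue_nullS (lebesgue_null_bigcup d_gt0 H
  (F := fun h => translate (boundary W) (- h) `|` translate (boundary W') (- h)) _).
  move=> x [h Hh bx]; rewrite -bigcup_seq; exists h => //.
  by case: bx => bx; [left|right]; exists (x + h); rewrite ?addrK.
by move=> h; apply: lebesgue_nullU; exact: lebesgue_null_translate.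
Qed.

Lemma riemann_measurable_piece (d_gt0 : (0 < d)%N) W W' H P :
  riemann_measurable W -> riemann_measurable W' -> P `<=` W ->
  pattern_determined W W' H P -> riemann_measurable P.
Proof.
move=> [bW W0] [_ W'0] PW HP; split; first exact: bounded_setS bW.
apply: lebesgue_nullS (boundary_pattern_determined HP) _.
exact: pattern_boundary_null.
Qed.

End Patterns.

Section Polytopes.
Context {R : realType} {d : nat}.
Notation V := 'rV[R]_d.
Notation vertices := 'M[R]_(1 + d, d).
Implicit Types (x y g h : V) (H : seq V) (A B : vertices) (s : seq vertices).
Implicit Types (l : 'cV[R]_(1 + d)) (ls : seq 'cV[R]_(1 + d)) (P Q W : set V).

Lemma polytopeP P : polytope P <-> exists s, simplicial s P.
Proof.
split=> [[n [S [simS triv ->]]]|[s [us /(pairwiseP (0 : vertices)) dj ->]]].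
  have /choice[A AP] : forall j, exists A, nondegenerate A /\ S j = hull A.
    by move=> j; have /simplexP[A uA SA] := simS j; exists A.
  have uA j : nondegenerate (A j) by have [] := AP j.
  exists [seq A j | j <- enum 'I_n]; split.
  - by move=> B /mapP[j _ ->].
  - rewrite pairwise_map; have := enum_uniq 'I_n; rewrite uniq_pairwise.
    apply: sub_pairwise => i j /= ij; apply/asboolP; rewrite -subset0 => x xij.
    have : i = j; last by move/eqP; rewrite (negPf ij).
    apply: triv => //; have [_ ->] := AP i; have [_ ->] := AP j.
    by rewrite !interior_hull //; exists x.
  - apply/seteqP; split=> [x [j _]|x [B /mapP[j _ ->]]].
      have [_ ->] := AP j => xj; exists (A j) => //.
      by apply/mapP; exists j; rewrite ?mem_enum.
    by have [_ <-] := AP j; exists j.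
exists (size s), (fun j => hull (nth 0 s j)).
have uj (j : 'I_(size s)) : nondegenerate (nth 0 s j) by apply/us/mem_nth.
split.
- by move=> j; apply/simplexP; exists (nth 0 s j).
- move=> i j _ _; rewrite !interior_hull // => -[x [xi xj]].
  have disj (k m : 'I_(size s)) : (k < m)%N ->
      ohull (nth 0 s k) x -> ohull (nth 0 s m) x -> False.
    move=> km xk xm; have /asboolP := dj k m (ltn_ord k) (ltn_ord m) km.
    by rewrite -subset0; apply; split; [exact: xk|].
  apply: val_inj => /=; case: (ltngtP i j) => // lt_ij; exfalso.
    exact: disj lt_ij xi xj.
  exact: disj lt_ij xj xi.
- apply/seteqP; split=> [x [B /(nthP 0)[j js <-] xB]|x [j _ xj]].
    by exists (Ordinal js).
  by exists (nth 0 s j) => //; exact: mem_nth.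
Qed.

(** Membership in a polytope is decided by the signs of the finitely many affine
    functions that define the facets of its simplices. *)
Lemma simplicial_facets s P : simplicial s P -> exists2 ls : seq 'cV[R]_(1 + d),
  {in ls, forall l, exists x0, aff l x0 != 0} &
  forall x y, {in ls, forall l, (0 <= aff l x) = (0 <= aff l y)} -> P x -> P y.
Proof.
move=> [us _ ->]; exists [seq facet A i | A <- s, i <- enum 'I_(1 + d)].
  move=> l /allpairsP[[A i] /= [sA _ ->]]; exists (row i A).
  by rewrite -bary_aff bary_vertex ?us // mxE !eqxx oner_eq0.
move=> x y xy [A sA xA]; exists A => // i; rewrite bary_aff -xy -?bary_aff //.
by apply/allpairsP; exists (A, i); rewrite mem_enum.
Qed.

Lemma aff_translate l g : exists l', forall x, aff l' x = aff l (x + g).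
Proof.
exists (col_mx (aff l g)%:M (dsubmx l)) => x.
rewrite !affE col_mxKu col_mxKd mxE eqxx mulr1n -addrA -big_split /=.
by congr (_ + _); apply: eq_bigr => j _; rewrite [(x + g) 0 j]mxE mulrDr addrC.
Qed.

Lemma polytope_sides P H : polytope P -> exists2 ls : seq 'cV[R]_(1 + d),
  {in ls, forall l, exists x0, aff l x0 != 0} &
  forall x y, {in ls, forall l, (0 <= aff l x) = (0 <= aff l y)} ->
  forall h, h \in H -> P (x + h) -> P (y + h).
Proof.
move=> /polytopeP[s /simplicial_facets[ls ls0 lsP]].
have /choice[tr trE] : forall lg : 'cV[R]_(1 + d) * V,
    exists l', forall x, aff l' x = aff lg.1 (x + lg.2).
  by move=> [l g]; exact: aff_translate.
exists [seq tr (l, h) | l <- ls, h <- H].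
  move=> _ /allpairsP[[l h] /= [/ls0[x0 lx0] _ ->]]; exists (x0 - h).
  by rewrite trE /= subrK.
move=> x y xy h Hh; apply: lsP => l sl.
by have := xy (tr (l, h)); rewrite !trE; apply; apply/allpairsP; exists (l, h).
Qed.

Lemma polytope_riemann_measurable (d_gt0 : (0 < d)%N) P :
  polytope P -> riemann_measurable P.
Proof.
move=> /polytopeP[s [us _ ->]].
have -> : [set x | exists2 A, A \in s & hull A x] =
    \big[setU/set0]_(A <- s) hull A.
  by rewrite -bigcup_seq; apply/seteqP; split=> x [A sA xA]; exists A.
elim: s us => [|A s IH] us.
  rewrite big_nil; split; first by apply/bounded_setP; exists 1.
  apply: lebesgue_nullS (lebesgue_null0 d_gt0) => x [].
  by rewrite closure0.
have uA : nondegenerate A by apply: us; rewrite mem_head.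
have [|bs s0] := IH; first by move=> B sB; apply: us; rewrite inE sB orbT.
rewrite big_cons; split.
  apply: bounded_setU bs; exact: bounded_hull.
apply: lebesgue_nullS (lebesgue_nullU (boundary_hull_null d_gt0 uA) s0).
move=> x [] /=; rewrite closureU => cx nx.
case: cx => cx; [left|right]; split=> // ix; apply: nx; apply: interiorS ix.
  exact: subsetUl.
exact: subsetUr.
Qed.

(** The simplices of [W] are cut along the hyperplanes that bound the simplices
    of the translates of [W] and [W'] by [H]. On the interior of each small
    simplex the pattern is constant, hence so is membership in [P]; the polytope
    is the union of the small simplices with interior in [P], and the exceptional
    set consists of the boundaries of the small simplices. *)
Lemma polytope_piece (d_gt0 : (0 < d)%N) W W' H P :
  polytope W -> polytope W' -> P `<=` W -> pattern_determined W W' H P ->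
  exists P' E, [/\ polytope P', lebesgue_null E &
                   forall x, ~ E x -> (P x <-> P' x)].
Proof.
move=> pW pW' PW HP.
have [ls1 ls1_0 ls1P] := polytope_sides H pW.
have [ls2 ls2_0 ls2P] := polytope_sides H pW'.
have [s0 S0] := iffLR (polytopeP W) pW.
have [s [us dj WE] uncut_s] := subdivide_uncuts (ls1 ++ ls2) S0.
have ls0 : {in ls1 ++ ls2, forall l, exists x0, aff l x0 != 0}.
  by move=> l; rewrite mem_cat => /orP[/ls1_0|/ls2_0].
have ohullP A : A \in s -> forall x y, ohull A x -> ohull A y -> P x -> P y.
  move=> sA x y xA yA; apply: HP.
  have sgE l : l \in ls1 ++ ls2 -> (0 <= aff l x) = (0 <= aff l y).
    move=> sl; have [x0 lx0] := ls0 l sl.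
    have [lA|lA] := uncut_sign (us A sA) lx0 (uncut_s A l sA sl).
      by rewrite !ltW ?lA.
    by rewrite !leNgt !lA.
  have sg1 l : l \in ls1 -> (0 <= aff l x) = (0 <= aff l y).
    by move=> sl; apply: sgE; rewrite mem_cat sl.
  have sg2 l : l \in ls2 -> (0 <= aff l x) = (0 <= aff l y).
    by move=> sl; apply: sgE; rewrite mem_cat sl orbT.
  move=> h Hh; split; split.
  - exact: ls1P Hh.
  - by apply: ls1P Hh => l sl; rewrite sg1.
  - exact: ls2P Hh.
  - by apply: ls2P Hh => l sl; rewrite sg2.
pose s' := [seq A <- s | `[< ohull A `<=` P >]].
exists [set x | exists2 A, A \in s' & hull A x].
exists (\big[setU/set0]_(A <- s) (if A \in s then boundary (hull A) else set0)).
split.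
- apply/polytopeP; exists s'; split=> //.
    by move=> A; rewrite mem_filter => /andP[_ /us].
  by apply: subseq_pairwise dj; exact: filter_subseq.
- apply: (lebesgue_null_bigcup d_gt0) => A; case: ifP => [sA|_].
    by apply: (boundary_hull_null d_gt0); exact: us.
  exact: lebesgue_null0.
- move=> x Ex.
  have hull_in A : A \in s -> hull A x -> ohull A x.
    move=> sA xA; apply: contrapT => xoA; apply: Ex; rewrite -bigcup_seq.
    exists A => //; rewrite sA; split; first exact: subset_closure.
    by rewrite interior_hull // us.
  split=> [Px|[A]].
    have := PW x Px; rewrite {1}WE => -[A sA xA]; exists A => //.
    rewrite mem_filter sA andbT; apply/asboolP => y yA.
    by apply: (ohullP A sA x) => //; exact: hull_in.
  by rewrite mem_filter => /andP[/asboolP AP sA] xA; apply/AP/hull_in.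
Qed.

End Polytopes.

(** * Lattices and recurrence *)

Section Lattices.
Context {R : realType} {d : nat}.
Notation V := 'rV[R]_d.
Notation T := (R * V)%type.
Variable Gamma : set T.
Hypothesis Gamma_lattice : lattice Gamma.

Lemma lattice0 : Gamma 0.
Proof. by have [[G0 _] _ _] := Gamma_lattice; exact: set_mem G0. Qed.

Lemma latticeB g h : Gamma g -> Gamma h -> Gamma (g - h).
Proof.
by move=> Gg Gh; have [[_ GB] _ _] := Gamma_lattice; apply: set_mem;
   apply: GB; exact: mem_set.
Qed.

Lemma latticeN g : Gamma g -> Gamma (- g).
Proof. by move=> Gg; rewrite -sub0r; exact: latticeB lattice0 Gg. Qed.

Lemma latticeD g h : Gamma g -> Gamma h -> Gamma (g + h).
Proof. by move=> Gg Gh; rewrite -[h]opprK; exact: latticeB Gg (latticeN Gh). Qed.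

Lemma lattice_separated :
  exists2 r : R, 0 < r & forall g h, Gamma g -> Gamma h -> `|g - h| < r -> g = h.
Proof.
have [_ iso _] := Gamma_lattice.
have [_ [U /nbhs_ballP[r /= r0 rU] UG]] := iso _ lattice0.
exists r => // g h Gg Gh gh; apply/eqP; rewrite -subr_eq0; apply/eqP.
have : (U `&` Gamma) (g - h).
  split; last exact: latticeB.
  by apply: rU; rewrite -ball_normE /= sub0r normrN.
by rewrite UG.
Qed.

Lemma compact_finite_net (X : normedModType R) (K : set X) (r : R) :
  0 < r -> compact K ->
  exists2 D : set X, finite_set D & forall x, K x -> exists2 c, D c & `|c - x| < r.
Proof.
move=> r0; rewrite compact_cover => /(_ X setT (fun c => ball c r)).
case=> [c _|x _|D _ KD]; first exact: ball_open.
  by exists x => //; exact: ballxx.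
exists [set` D]; first exact: finite_fset.
by move=> x /KD[c cD xc]; exists c => //; move: xc; rewrite -ball_normE.
Qed.

(** Two lattice points within half the separation radius of a common centre
    coincide, and finitely many centres are enough for a bounded region. *)
Lemma finite_lattice_window (M N : R) :
  finite_set (Gamma `&` [set g | `|g.1| <= M /\ `|g.2| <= N]).
Proof.
have [r r0 sep] := lattice_separated.
have r2 : 0 < r / 2 by rewrite divr_gt0.
have cpt (X : normedModType R) (A : R) :
    (forall B : set X, bounded_set B -> closed B -> compact B) ->
    compact [set v : X | `|v| <= A].
  apply.
    apply/bounded_setP; exists (`|A| + 1); first by rewrite ltr_wpDl.
    by move=> v /= vA; have := ler_norm A; lra.
  apply: (@preimage_closed _ _ (fun v : X => `|v|) [set a : R | a <= A]).
    by move=> v _; exact: norm_continuous.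
  exact: closed_le.
have Mcpt : compact [set a : R^o | `|a| <= M].
  have -> : [set a : R^o | `|a| <= M] = `[- M, M]%classic.
    by apply/seteqP; split=> a /=; rewrite in_itv /= ler_norml.
  exact: segment_compact.
have [D D_fin DM] := compact_finite_net r2 Mcpt.
have [E E_fin EN] := compact_finite_net r2 (cpt V N (@bounded_closed_compact R d)).
pose near_pt c := Gamma `&` [set g | `|c.1 - g.1| < r / 2 /\ `|c.2 - g.2| < r / 2].
pose pick c : T := get (near_pt c).
apply: (@sub_finite_set _ _ (pick @` (D `*` E))); last first.
  by apply: finite_image; exact: finite_setX.
move=> g [Gg [gM gN]]; have [a Da ag] := DM _ gM; have [b Eb bg] := EN _ gN.
exists (a, b) => //.
have [Gp [ap bp]] : near_pt (a, b) (pick (a, b)) by apply: getPex; exists g.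
apply: sep => //; rewrite prod_normE gt_max; apply/andP; split=> /=.
  have -> : (pick (a, b)).1 - g.1 = (a - g.1) - (a - (pick (a, b)).1).
    by rewrite opprB [RHS]addrC addrA subrK.
  by apply: le_lt_trans (ler_normB _ _) _; move: ag ap => /=; lra.
have -> : (pick (a, b)).2 - g.2 = (b - g.2) - (b - (pick (a, b)).2).
  by rewrite opprB [RHS]addrC addrA subrK.
by apply: le_lt_trans (ler_normB _ _) _; move: bg bp => /=; lra.
Qed.

(** [p] is either the first projection or its opposite, which allows time to be
    reversed. *)
Variable p : T -> R.
Hypothesis pB : forall g h, p (g - h) = p g - p h.
Hypothesis p_norm : forall g, `|p g| = `|g.1|.

Lemma height0 : p 0 = 0.
Proof. by rewrite -[0 in LHS](subrr 0) pB subrr. Qed.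

Lemma heightN g : p (- g) = - p g.
Proof. by rewrite -[- g]sub0r pB height0 sub0r. Qed.

Lemma heightD g h : p (g + h) = p g + p h.
Proof. by rewrite -[h in LHS]opprK pB heightN opprK. Qed.

Hypothesis d_gt0 : (0 < d)%N.
Hypothesis p2_dense : dense (snd @` Gamma).

Lemma seq_min_norm (s : seq T) :
  exists2 e : R, 0 < e & forall g, g \in s -> g.2 != 0 -> e <= `|g.2|.
Proof.
elim: s => [|h s [e e0 es]]; first by exists 1.
have [h0|h0] := eqVneq h.2 0.
  by exists e => // g; rewrite inE => /orP[/eqP ->|/es //]; rewrite h0 eqxx.
exists (Num.min e `|h.2|); first by rewrite lt_min e0 normr_gt0.
move=> g; rewrite inE => /orP[/eqP -> _|/es gs /gs eg].
  by rewrite ge_min lexx orbT.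
by rewrite ge_min eg.
Qed.

(** Only finitely many lattice points of height at most [c] project near the
    origin, and the projections accumulate there; a lattice point whose
    projection is closer to [0] than all the nonzero ones among them is high, up
    to sign. *)
Lemma small_high_step (e c : R) : 0 < e ->
  exists g, [/\ Gamma g, c < p g & `|g.2| < e].
Proof.
move=> e0; have /finite_seqP[s sE] := finite_lattice_window `|c| e.
have [m m0 ms] := seq_min_norm s.
pose r := Num.min e m; have r0 : 0 < r by rewrite lt_min e0.
pose O : set V := [set v | 0 < `|v| < r].
have Oopen : open O.
  have -> : O = (fun v : V => `|v|) @^-1` ([set a : R | 0 < a] `&` [set a | a < r]).
    by apply/seteqP; split=> v /=; [move=> /andP[]|move=> [? ?]; apply/andP].
  apply: open_comp; first by move=> v _; exact: norm_continuous.
  by apply: openI; [exact: open_gt|exact: open_lt].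
have O0 : O !=set0.
  pose u : V := const_mx 1; have u0 : 0 < `|u|.
    rewrite normr_gt0; apply/eqP => /rowP/(_ (Ordinal d_gt0)); rewrite !mxE.
    by move/eqP; rewrite oner_eq0.
  exists ((r / 2 / `|u|) *: u); rewrite /O /= normrZ normrM normfV normr_id.
  by rewrite divfK ?gt_eqF // gtr0_norm ?divr_gt0 //=; lra.
have [w [/andP[g0 gr] [g Gg gE]]] := p2_dense O0 Oopen.
move: g0 gr; rewrite -{w}gE => g0; rewrite lt_min => /andP[ge gm].
have cg : `|c| < `|g.1|.
  rewrite ltNge; apply/negP => gc.
  have : (Gamma `&` [set g | `|g.1| <= `|c| /\ `|g.2| <= e]) g.
    by split=> //; split=> //; exact: ltW.
  rewrite sE => gs; have := ms g gs; rewrite -normr_gt0 g0 => /(_ isT).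
  by rewrite leNgt gm.
have := ler_norm c; rewrite -p_norm in cg.
have [p_ge0|p_lt0] := leP 0 (p g) => c_le.
  by exists g; split=> //; rewrite (ger0_norm p_ge0) in cg; lra.
exists (- g); split; first exact: latticeN.
  by rewrite heightN; rewrite (ltr0_norm p_lt0) in cg; lra.
by rewrite normrN.
Qed.

(** By density every point of the space reaches [U] by a translation from
    [snd @` Gamma], with positive height after a small correction
    ([small_high_step]); compactness makes the height uniformly bounded. *)
Lemma recurrence (U B : set V) : open U -> U !=set0 -> bounded_set B ->
  exists2 L : R, 0 < L & forall x, B x ->
    exists g, [/\ Gamma g, 0 < p g <= L & U (x + g.2)].
Proof.
move=> Uopen [u0 Uu0] /bounded_setP[M M0 BM].
have addC (v : V) : continuous (fun x : V => x + v).
  by move=> x; apply: continuousD; [exact: cvg_id|exact: cst_continuous].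
have openU v : open [set x : V | U (x + v)].
  apply: (@open_comp _ _ (fun x : V => x + v) U) => // x _; exact: addC.
have Kcpt : compact [set v : V | `|v| <= M].
  apply: bounded_closed_compact; first by apply/bounded_setP; exists M.
  apply: (@preimage_closed _ _ (fun v : V => `|v|) [set a : R | a <= M]).
    by move=> v _; exact: norm_continuous.
  exact: closed_le.
have Kcover : cover_compact [set v : V | `|v| <= M] by rewrite -(compact_cover V).
have := Kcover T [set g | Gamma g /\ 0 < p g] (fun g => [set x | U (x + g.2)]).
case=> [g _|x _|D DG KD]; first exact: openU.
  have [|v [/= Uv [g Gg gv]]] := p2_dense _ (openU x).
    by exists (u0 - x); rewrite /= subrK.
  have /nbhs_ballP[e /= e0 eU] : nbhs (v + x) U by apply: open_nbhs_nbhs.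
  have [h [Gh ph he]] := small_high_step (- p g) e0.
  exists (g + h); first by split; [exact: latticeD|rewrite heightD; lra].
  apply: eU; rewrite -ball_normE /= gv.
  have -> : v + x - (x + (v + h.2)) = - h.2.
    by rewrite addrA [x + v]addrC opprD addNKr.
  by rewrite normrN.
exists (1 + \sum_(g <- D) `|p g|).
  by rewrite ltr_pwDl // sumr_ge0.
move=> x /BM xM; have [g gD xg] := KD x xM.
have [Gg pg] : Gamma g /\ 0 < p g by apply/set_mem/DG.
exists g; split=> //; rewrite pg /= (big_rem g) //= gtr0_norm //.
by rewrite addrCA lerDl addr_ge0 // sumr_ge0.
Qed.

End Lattices.

(** * Discrepancy and the matching of visits *)

Lemma finite_argmin (R : realType) (T : choiceType) (A : set T) (f : T -> R) :
  finite_set A -> A !=set0 -> exists2 a, A a & forall b, A b -> f a <= f b.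
Proof.
move=> /finite_seqP[s ->]; elim: s => [[x]//|x [|y s] IH _].
  by exists x => [|b]; rewrite /= inE; [rewrite eqxx|move/eqP ->].
have [|a sa amin] := IH; first by exists y; rewrite /= inE eqxx.
have [xa|ax] := leP (f x) (f a).
  exists x => [|b]; first by rewrite /= inE eqxx.
  rewrite /= inE => /orP[/eqP -> //|sb]; exact: le_trans xa (amin b sb).
exists a => [|b]; first by rewrite /= inE sa orbT.
by rewrite /= inE => /orP[/eqP ->|/amin //]; exact: ltW.
Qed.

Lemma int_bounded_max (A : set int) (c : int) :
  A !=set0 -> (forall z, A z -> z <= c) -> exists2 m, A m & forall z, A z -> z <= m.
Proof.
move=> [z0 Az0] Ac; have [n nE] : exists n : nat, c - z0 <= n%:Z.
  by exists `|c - z0|%N; rewrite abszE ler_norm.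
elim: n z0 Az0 nE => [|n IH] z0 Az0 nE.
  by exists z0 => // z /Ac; move: nE; lia.
have [[z Az z0z]|nz] := pselect (exists2 z, A z & z0 < z).
  by apply: IH Az _; lia.
by exists z0 => // z Az; rewrite leNgt; apply/negP => z0z; apply: nz; exists z.
Qed.

Section Discrepancy.
Context {R : realType} {d : nat}.
Notation V := 'rV[R]_d.
Notation T := (R * V)%type.
Implicit Types (x v : V) (g h k : T) (a b : R).

Definition sgn (W W' : set V) v : int :=
  (nat_of_bool `[< W v >])%:Z - (nat_of_bool `[< W' v >])%:Z.

Lemma sgn_swap (W W' : set V) v : sgn W' W v = - sgn W W' v.
Proof. by rewrite /sgn opprB. Qed.

Lemma sgn1 (W W' : set V) v : sgn W W' v = 1 <-> W v /\ ~ W' v.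
Proof.
rewrite /sgn; split.
  by case: asboolP => Wv; case: asboolP => W'v.
by case=> Wv W'v; rewrite asboolT // asboolF.
Qed.

Lemma sgnN1 (W W' : set V) v : sgn W W' v = -1 <-> W' v /\ ~ W v.
Proof.
rewrite -(sgn1 W' W) (sgn_swap W W'); split=> [->|/eqP]; first by rewrite opprK.
by rewrite eqr_oppLR => /eqP.
Qed.

Lemma sgn_cases (W W' : set V) v :
  sgn W W' v != 0 -> sgn W W' v = 1 \/ sgn W W' v = -1.
Proof.
rewrite /sgn; case: asboolP => _; case: asboolP => _; rewrite ?subrr ?eqxx //.
  by left.
by right.
Qed.

Variables (Gamma : set T) (p : T -> R) (W W' : set V).
Local Notation sg := (sgn W W').

Definition window x a b : set T :=
  Gamma `&` [set g | (a <= p g <= b) /\ sg (x + g.2) != 0].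

(** The number of visits to [W] minus the number of visits to [W'] along the
    translates of [x] by the lattice points with height in [[a, b]]. *)
Definition discrepancy x a b : int := \sum_(g \in window x a b) sg (x + g.2).

(** Reading the points of [W] outside [W'] as opening brackets and those of [W']
    outside [W] as closing brackets, in the order of their heights, [h] is the
    bracket that closes [g]. The last two conditions imply one another; with
    both of them the notion is visibly invariant under the reversal of time that
    exchanges [W] and [W']. *)
Definition matched x g h : Prop :=
  [/\ Gamma g /\ Gamma h, sg (x + g.2) = 1 /\ sg (x + h.2) = -1,
      p g < p h /\ discrepancy x (p g) (p h) = 0,
      forall k, Gamma k -> sg (x + k.2) != 0 -> p g <= p k < p h ->
        1 <= discrepancy x (p g) (p k)
    & forall k, Gamma k -> sg (x + k.2) != 0 -> p g < p k <= p h ->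
        discrepancy x (p k) (p h) <= -1].

Definition regular a b : Prop := forall k, Gamma k -> a <= p k <= b ->
  ~ boundary W k.2 /\ ~ boundary W' k.2.

Hypothesis Gamma_lattice : lattice Gamma.
Hypothesis pB : forall g h, p (g - h) = p g - p h.
Hypothesis p_norm : forall g, `|p g| = `|g.1|.
Hypothesis p_inj : forall g h, Gamma g -> Gamma h -> p g = p h -> g = h.
Variable M : R.
Hypothesis W_bounded : forall v, W v -> `|v| <= M.
Hypothesis W'_bounded : forall v, W' v -> `|v| <= M.

Let pD := heightD pB.
Let pN := heightN pB.

Lemma sgn_bounded v : sg v != 0 -> `|v| <= M.
Proof.
by case/sgn_cases => [/sgn1|/sgnN1] []; [move/W_bounded|move/W'_bounded].
Qed.

Lemma window_finite x a b : finite_set (window x a b).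
Proof.
apply: sub_finite_set
  (finite_lattice_window Gamma_lattice (`|a| + `|b|) (M + `|x|)).
move=> g [Gg [/andP[ag gb] /sgn_bounded xg]]; split=> //; split.
  rewrite -p_norm ler_norml; apply/andP; split.
    by have := ler_norm (- a); rewrite normrN; have := normr_ge0 b; lra.
  by have := ler_norm b; have := normr_ge0 a; lra.
have -> : g.2 = (x + g.2) - x by rewrite addrC addKr.
by apply: le_trans (ler_normB _ _) _; rewrite lerD2r.
Qed.

Lemma discrepancy_shift x g a b : Gamma g ->
  discrepancy (x + g.2) a b = discrepancy x (a + p g) (b + p g).
Proof.
move=> Gg; rewrite /discrepancy.
rewrite [RHS](reindex_fsbig (fun k => k + g) (window (x + g.2) a b)).
  by apply: eq_fsbigr => k _; rewrite /= [k.2 + _]addrC addrA.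
split=> [k [Gk [kab kx]]|k l _ _ /addIr //|k [Gk [kab kx]]].
  split; first exact: (latticeD Gamma_lattice).
  by rewrite /= pD !lerD2r [k.2 + _]addrC addrA.
exists (k - g); last by rewrite subrK.
split; first exact: (latticeB Gamma_lattice).
by rewrite /= pB lerBrDr lerBlDr [k.2 - _]addrC addrA addrK.
Qed.

Lemma discrepancy1 x g : Gamma g -> sg (x + g.2) != 0 ->
  discrepancy x (p g) (p g) = sg (x + g.2).
Proof.
move=> Gg sg0; rewrite /discrepancy.
have -> : window x (p g) (p g) = [set g]; last by rewrite fsbig_set1.
apply/seteqP; split=> [k [Gk [gk _]]|_ ->]; last by split=> //=; rewrite lexx.
by apply: p_inj => //; apply/eqP; rewrite eq_le andbC.
Qed.

Lemma discrepancy_split x a b (c1 c2 : R) : a <= c2 -> c1 < c2 -> c1 <= b ->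
  (forall k, Gamma k -> sg (x + k.2) != 0 -> c1 < p k -> c2 <= p k) ->
  discrepancy x a b = discrepancy x a c1 + discrepancy x c2 b.
Proof.
move=> ac2 c12 c1b gap; rewrite {1}/discrepancy.
rewrite (fsbigID [set g | p g <= c1] _ _ (window_finite x a b)) /=.
congr (_ + _); apply: eq_fsbigl; apply/seteqP; split=> k.
- by move=> [[Gk [/andP[ak kb] kx]] /= kc]; split=> //; split=> //; rewrite ak.
- move=> [Gk [/andP[ak kc] kx]]; split=> //; split=> //; split=> //.
  by rewrite ak (le_trans kc).
- move=> [[Gk [/andP[ak kb] kx]] /= /negP]; rewrite -ltNge => kc.
  by split=> //; split=> //; rewrite kb andbT; exact: gap.
- move=> [Gk [/andP[ck kb] kx]]; split; last first.
    by move=> /= kc; have := le_lt_trans kc (lt_le_trans c12 ck); rewrite ltxx.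
  by split=> //; split=> //; rewrite kb (le_trans ac2).
Qed.

(** Past [g], the discrepancy is unchanged between two consecutive visits, so it
    may be evaluated at the last visit [m] before a given height [u]. *)
Lemma last_before x g (u : R) : Gamma g -> sg (x + g.2) != 0 -> p g < u ->
  exists m, [/\ Gamma m, sg (x + m.2) != 0, p g <= p m < u
    & forall b, u <= b ->
      discrepancy x (p g) b = discrepancy x (p g) (p m) + discrepancy x u b].
Proof.
move=> Gg gx gu; pose A := window x (p g) u `&` [set m | p m < u].
have A_fin : finite_set A by apply: finite_setIl; exact: window_finite.
have [|m [[Gm [/andP[gm _] mx]] /= mu] mmax] :=
    finite_argmin (fun m => - p m) A_fin.
  by exists g; split=> //; split=> //; split=> //; rewrite lexx ltW.
exists m; split=> //; first by rewrite gm.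
move=> b ub; apply: discrepancy_split => //; first exact: ltW.
  exact: le_trans (ltW mu) ub.
move=> k Gk kx mk; rewrite leNgt; apply/negP => ku.
have := mmax k; rewrite lerN2 leNgt mk => H; suff: false by [].
apply: H; split=> //; split=> //; split=> //.
by rewrite (le_trans gm (ltW mk)) ltW.
Qed.

Lemma matched_shift x g h k : Gamma k ->
  matched (x + k.2) g h -> matched x (g + k) (h + k).
Proof.
have kE (l : T) : x + (l + k).2 = x + k.2 + l.2 by rewrite /= [l.2 + _]addrC addrA.
move=> Gk [[Gg Gh] [g1 h1] [gh D0] Ha Hb]; split.
- by split; exact: (latticeD Gamma_lattice).
- by rewrite !kE.
- by rewrite !pD ltrD2r -discrepancy_shift.
- move=> l Gl lx; rewrite !pD -lerBrDr -ltrBlDr -pB => gl.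
  rewrite -[p l](subrK (p k)) -discrepancy_shift // -pB; apply: Ha => //.
    exact: (latticeB Gamma_lattice).
  by move: lx; rewrite -{1}[l](subrK k) kE.
- move=> l Gl lx; rewrite !pD -lerBlDr -ltrBrDr -pB => gl.
  rewrite -[p l](subrK (p k)) -discrepancy_shift // -pB; apply: Hb => //.
    exact: (latticeB Gamma_lattice).
  by move: lx; rewrite -{1}[l](subrK k) kE.
Qed.

Lemma matched_right_unique x g h h' : matched x g h -> matched x g h' -> h = h'.
Proof.
move=> [[_ Gh] [_ hx] [gh D0] Ha _] [[_ Gh'] [_ h'x] [gh' D0'] Ha' _].
apply: p_inj => //; case: (ltgtP (p h) (p h')) => // hh'.
  by have := Ha' h Gh; rewrite hx D0 (ltW gh) hh' => /(_ isT isT).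
by have := Ha h' Gh'; rewrite h'x D0' (ltW gh') hh' => /(_ isT isT).
Qed.

Lemma matched_left_unique x g g' h : matched x g h -> matched x g' h -> g = g'.
Proof.
move=> [[Gg _] [gx _] [gh D0] _ Hb] [[Gg' _] [g'x _] [g'h D0'] _ Hb'].
apply: p_inj => //; case: (ltgtP (p g) (p g')) => // gg'.
  by have := Hb g' Gg'; rewrite g'x D0' (ltW g'h) gg' => /(_ isT isT).
by have := Hb' g Gg; rewrite gx D0 (ltW gh) gg' => /(_ isT isT).
Qed.

(** The first visit at which the discrepancy counted from [g] falls below [1] is
    the partner of [g]: as the discrepancy changes by steps of [1], it is [0]
    there. *)
Lemma matched_of_return x g m : Gamma g -> sg (x + g.2) = 1 ->
  Gamma m -> sg (x + m.2) != 0 -> p g <= p m -> discrepancy x (p g) (p m) <= 0 ->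
  exists2 h, matched x g h & p h <= p m.
Proof.
move=> Gg gx Gm mx gm Dm; have gx0 : sg (x + g.2) != 0 by rewrite gx.
pose A := window x (p g) (p m) `&` [set k | discrepancy x (p g) (p k) <= 0].
have A_fin : finite_set A by apply: finite_setIl; exact: window_finite.
have [|h [[Gh [/andP[gh hm] hx]] /= Dh] hmin] := finite_argmin p A_fin.
  by exists m; split=> //; split=> //; split=> //; rewrite gm lexx.
have before k : Gamma k -> sg (x + k.2) != 0 -> p g <= p k < p h ->
    1 <= discrepancy x (p g) (p k).
  move=> Gk kx /andP[gk kh]; rewrite leNgt; apply/negP => Dk.
  suff : p h <= p k by rewrite leNgt kh.
  apply: hmin; split=> //; split=> //; split=> //.
  by rewrite gk (le_trans (ltW kh)).
have {}gh : p g < p h.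
  rewrite lt_neqAle gh andbT; apply/eqP => gh'; move: Dh.
  by rewrite -gh' discrepancy1 // gx.
have [l [Gl lx glh Dl]] := last_before Gg gx0 gh.
have Dhl := Dl (p h) (lexx _); rewrite discrepancy1 // in Dhl.
have D1 := before l Gl lx glh.
have hxN : sg (x + h.2) = -1.
  by case: (sgn_cases hx) => hx1 //; move: Dhl; rewrite hx1; lia.
have D0 : discrepancy x (p g) (p h) = 0 by move: Dhl; rewrite hxN; lia.
exists h => //; split=> // k Gk kx /andP[gk kh].
have [q [Gq qx /andP[gq qk] Dq]] := last_before Gg gx0 gk.
have := Dq _ kh; rewrite D0.
have := before q Gq qx; rewrite gq (lt_le_trans qk kh) => /(_ isT).
lia.
Qed.

(** For [y] near [g.2], the lattice points with large second projection
    contribute nothing, and the others form a finite pattern. *)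
Lemma regular_window_open g (t : R) : Gamma g -> regular (p g) (p g + t) ->
  exists U : set V, [/\ open U, U g.2 & forall y k, U y -> Gamma k ->
    0 <= p k <= t -> sg (y + k.2) = sg (g.2 + k.2)].
Proof.
move=> Gg reg; pose N := M + `|g.2| + 1.
have /finite_seqP[s sE] := finite_lattice_window Gamma_lattice t N.
pose H := [seq k.2 | k <- s & 0 <= p k].
have bg : ~ pattern_boundary W W' H g.2.
  move=> [_ /mapP[k + ->]]; rewrite mem_filter => /andP[k0 ks].
  have : [set` s] k by [].
  rewrite -sE => -[Gk [kt _]] bk.
  have [|b1 b2] := reg (g + k) (latticeD Gamma_lattice Gg Gk).
    rewrite pD lerDl k0 lerD2l; rewrite -p_norm in kt.
    exact: le_trans (ler_norm _) kt.
  by case: bk.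
have nU : \forall y \near g.2, same_pattern W W' H y g.2 /\ `|g.2 - y| < 1.
  apply: filterI; first exact: near_same_pattern.
  have : nbhs g.2 (ball g.2 (1 : R)) by exact: nbhsx_ballx.
  by rewrite -ball_normE.
exists (interior [set y | same_pattern W W' H y g.2 /\ `|g.2 - y| < 1]).
split; [exact: open_interior|exact: nU|].
move=> y k /interior_subset[same gy] Gk /andP[k0 kt].
have [kN|Nk] := leP `|k.2| N.
  have : (Gamma `&` [set g | `|g.1| <= t /\ `|g.2| <= N]) k.
    by split=> //; rewrite /= -p_norm ger0_norm.
  rewrite sE => ks; have Hk : k.2 \in H.
    by apply/mapP; exists k; rewrite // mem_filter k0.
  have [WE W'E] := same _ Hk; rewrite /sgn.
  by congr (_ - _); congr (nat_of_bool _)%:Z; apply/asbool_equiv_eq.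
have far v : `|v| <= `|g.2| + 1 -> sg (v + k.2) = 0.
  move=> vg; apply/eqP; apply/negPn/negP => /sgn_bounded vk.
  have : `|k.2| <= M + `|v|.
    have -> : k.2 = (v + k.2) - v by rewrite addrC addKr.
    by apply: le_trans (ler_normB _ _) _; rewrite lerD2r.
  by move: Nk; rewrite /N; lra.
rewrite !far // ?lerDl //.
have -> : y = g.2 - (g.2 - y) by rewrite opprB addrC subrK.
by apply: le_trans (ler_normB _ _) _; rewrite lerD2l ltW.
Qed.

Hypothesis d_gt0 : (0 < d)%N.
Hypothesis p2_dense : dense (snd @` Gamma).
Variable C : int.
Hypothesis discrepancy_le : forall a b, discrepancy 0 a b <= C.

(** Let [D] be the largest discrepancy of a regular interval. An interval with
    that discrepancy recurs beyond [g] at bounded distance; if the discrepancy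
    counted from [g] had not returned to [0] before it, the interval from [g] to
    the end of the recurring one would have discrepancy at least [D + 1]. *)
Lemma regular_matched : exists2 L : R, 0 < L &
  forall g, Gamma g -> sg g.2 = 1 -> regular (p g) (p g + L) ->
    exists2 h, matched 0 g h & p h <= p g + L.
Proof.
pose A : set int := [set z | exists g h, [/\ Gamma g, Gamma h, p g <= p h,
  regular (p g) (p h) & z = discrepancy 0 (p g) (p h)]].
have [A0|nA] := pselect (A !=set0); last first.
  exists 1 => // g Gg _ reg; exfalso; apply: nA.
  exists (discrepancy 0 (p g) (p g)), g, g; split=> // k Gk /andP[gk kg].
  by apply: reg => //; rewrite gk (le_trans kg) // lerDl.
have [|D [e [f [Ge Gf ef reg DE]]] Dmax] := int_bounded_max (c := C) A0.
  by move=> _ [g [h [_ _ _ _ ->]]].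
pose t := p f - p e.
have [|U [Uopen Ue Usg]] := regular_window_open (t := t) Ge.
  by rewrite /t addrC subrK.
have bW : bounded_set W by apply/bounded_setP; exists (`|M| + 1);
  [rewrite ltr_wpDl|move=> v /W_bounded vM; have := ler_norm M; lra].
have [|r r0 rec] := recurrence Gamma_lattice pB p_norm d_gt0 p2_dense Uopen _ bW.
  by exists e.2.
have t0 : 0 <= t by rewrite subr_ge0.
exists (r + t) => [|g Gg gx regg]; first by rewrite ltr_pwDl.
have [Wg _] := iffLR (sgn1 _ _ _) gx.
have [k [Gk /andP[k0 kr] Uk]] := rec _ Wg.
have {}Uk : U (g + k).2 by exact: Uk.
have Ggk := latticeD Gamma_lattice Gg Gk.
have De : discrepancy 0 (p (g + k)) (p (g + k) + t) = D.
  have -> : discrepancy 0 (p (g + k)) (p (g + k) + t) =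
      discrepancy (g + k).2 0 t.
    by have := discrepancy_shift 0 0 t Ggk; rewrite !add0r [t + _]addrC.
  have -> : D = discrepancy e.2 0 t.
    by have := discrepancy_shift 0 0 t Ge; rewrite !add0r /t subrK DE.
  have wE : window (g + k).2 0 t = window e.2 0 t.
    apply/seteqP; split=> l [Gl [lt lx]]; split=> //; split=> //.
      by rewrite -(Usg _ l Uk Gl lt).
    by rewrite (Usg _ l Uk Gl lt).
  rewrite /discrepancy wE; apply: eq_fsbigr => l /set_mem[Gl [lt _]].
  exact: Usg.
have Dg : discrepancy 0 (p g) (p (g + k) + t) <= D.
  apply: Dmax; exists g, (g + k + (f - e)); split=> //.
  - apply: (latticeD Gamma_lattice) => //; exact: (latticeB Gamma_lattice).
  - by rewrite !pD pN -/t; lra.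
  - move=> l Gl /andP[gl]; rewrite !pD pN -/t => lk; apply: regg => //.
    by rewrite gl; lra.
  - by rewrite [in RHS]pD pB.
have gx0 : sg (0 + g.2) != 0 by rewrite add0r gx.
have [|m [Gm mx /andP[gm mk] Dm]] := last_before (u := p (g + k)) Gg gx0.
  by rewrite pD ltrDl.
have := Dm (p (g + k) + t); rewrite lerDl De => /(_ t0) Dgm.
have gx1 : sg (0 + g.2) = 1 by rewrite add0r.
have Dm0 : discrepancy 0 (p g) (p m) <= 0 by move: Dg Dgm; lia.
have [h gh hm] := matched_of_return Gg gx1 Gm mx gm Dm0.
exists h => //; apply: le_trans hm (le_trans (ltW mk) _).
by rewrite pD; lra.
Qed.

End Discrepancy.

(** * Bounded distance and bounded discrepancy *)

Definition cnt (T : choiceType) (A : set T) : nat := size (enum_fset (fset_set A)).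

Section Counting.
Variable T : choiceType.
Implicit Types (A B : set T).

Lemma cnt_inj A B (f : T -> T) : finite_set A -> finite_set B ->
  (forall a, A a -> B (f a)) ->
  (forall a b, A a -> A b -> f a = f b -> a = b) -> (cnt A <= cnt B)%N.
Proof.
move=> A_fin B_fin fAB f_inj.
have memA a : a \in enum_fset (fset_set A) -> A a.
  by rewrite (in_fset_set A_fin) => /set_mem.
rewrite /cnt -(size_map f); apply: uniq_leq_size.
  rewrite map_inj_in_uniq ?fset_uniq // => a b /memA Aa /memA Ab; exact: f_inj.
move=> _ /mapP[a /memA Aa ->]; rewrite (in_fset_set B_fin).
by apply: mem_set; exact: fAB.
Qed.

Lemma cntU A B : finite_set A -> finite_set B -> (cnt (A `|` B) <= cnt A + cnt B)%N.
Proof.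
move=> A_fin B_fin; rewrite /cnt -size_cat; apply: uniq_leq_size => [|a].
  exact: fset_uniq.
rewrite mem_cat !in_fset_set ?finite_setU // => /set_mem[] Aa.
  by rewrite (mem_set Aa).
by rewrite (mem_set Aa) orbT.
Qed.

Lemma cnt_filter A B (r : seq T) : uniq r -> A = [set` r] `&` B ->
  cnt A = count (fun a => `[< B a >]) r.
Proof.
move=> r_uniq AE; have A_fin : finite_set A.
  by rewrite AE; apply: finite_setIl; exact: finite_seq.
rewrite -size_filter; apply/perm_size/uniq_perm.
- exact: fset_uniq.
- exact: filter_uniq.
move=> a; rewrite mem_filter in_fset_set // AE; apply/idP/andP.
  by move=> /set_mem[ar Ba]; split=> //; exact/asboolP.
by move=> [/asboolP Ba ar]; apply: mem_set.
Qed.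

End Counting.

Lemma bounded_distance_equivalent_sym (R : realType) (L L' : set R) :
  bounded_distance_equivalent L L' -> bounded_distance_equivalent L' L.
Proof.
move=> [K [K0 [chi [[chiL chi_inj chi_surj] chiK]]]]; exists K; split=> //.
have /choice[psi psiP] : forall y, exists x, L' y -> L x /\ chi x = y.
  move=> y; have [L'y|nL'y] := pselect (L' y); last by exists y.
  by have [x Lx xy] := chi_surj y L'y; exists x.
exists psi; split; first split.
- by move=> y /psiP[].
- move=> y z /set_mem/psiP[_ yE] /set_mem/psiP[_ zE] yz.
  by rewrite -yE -zE yz.
- move=> x Lx; exists (chi x); first exact: chiL.
  have [Lp pE] := psiP _ (chiL x Lx); apply: chi_inj => //; exact: mem_set.
- move=> y /psiP[Lp pE]; rewrite -{2}pE distrC; exact: chiK.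
Qed.

Section ModelSetCounts.
Context {R : realType} {d : nat}.
Notation V := 'rV[R]_d.
Notation T := (R * V)%type.
Variables (Gamma : set T) (Gamma_lattice : lattice Gamma).

Definition slab (p : T -> R) (A : set V) (a b : R) : set T :=
  Gamma `&` [set g | (a <= p g <= b) /\ A g.2].

Lemma slab_finite (p : T -> R) (A : set V) a b :
  (forall g, `|p g| = `|g.1|) -> bounded_set A -> finite_set (slab p A a b).
Proof.
move=> p_norm /bounded_setP[M M0 AM]; apply: sub_finite_set
  (finite_lattice_window Gamma_lattice (`|a| + `|b|) M).
move=> g [Gg [/andP[ag gb] /AM gM]]; split=> //; split=> //.
rewrite -p_norm ler_norml; apply/andP; split.
  by have := ler_norm (- a); rewrite normrN; have := normr_ge0 b; lra.
by have := ler_norm b; have := normr_ge0 a; lra.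
Qed.

Lemma discrepancy_cnt (p : T -> R) (W W' : set V) a b :
  (forall g, `|p g| = `|g.1|) -> bounded_set W -> bounded_set W' ->
  discrepancy Gamma p W W' 0 a b =
  (cnt (slab p W a b))%:Z - (cnt (slab p W' a b))%:Z.
Proof.
move=> p_norm bW bW'; pose r := enum_fset (fset_set (slab p (W `|` W') a b)).
have r_uniq : uniq r by exact: fset_uniq.
have rE g : g \in r -> slab p (W `|` W') a b g.
  rewrite in_fset_set; first by move/set_mem.
  by apply: slab_finite => //; exact: bounded_setU.
have Er g : slab p (W `|` W') a b g -> g \in r.
  move=> rg; rewrite in_fset_set; first exact: mem_set.
  by apply: slab_finite => //; exact: bounded_setU.
rewrite /discrepancy (fsbig_fwiden r) //; last 2 first.
- move=> g [Gg [gab]]; rewrite add0r => g0; apply: Er; split=> //; split=> //.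
  by case/sgn_cases: g0 => [/sgn1|/sgnN1] [? _]; [left|right].
- move=> g [/= /rE[Gg [gab _]] ng]; apply/eqP/negPn/negP => g0; apply: ng.
  by split.
have cntE (A : set V) : A `<=` W `|` W' ->
    (cnt (slab p A a b))%:Z = \sum_(g <- r) (nat_of_bool `[< A g.2 >])%:Z.
  move=> AW; rewrite (@cnt_filter _ _ [set g | A g.2] r) //.
    by elim: (r) => [|g s IH]; rewrite ?big_nil // big_cons /= PoszD IH.
  apply/seteqP; split=> g; first by move=> [Gg [gab Ag]]; split=> //=; apply: Er;
    split=> //; split=> //; exact: AW.
  by move=> [/rE[Gg [gab _]] Ag]; split.
rewrite !cntE; [|exact: subsetUr|exact: subsetUl].
by rewrite -sumrB; apply: eq_bigr => g _; rewrite add0r.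
Qed.

Hypothesis p1_inj : forall g h, Gamma g -> Gamma h -> g.1 = h.1 -> g = h.

(** A bijection moving points by at most [K] sends the points of [[a, b]] into
    [[a - K, b + K]], and the two additional intervals of length [K] contain
    boundedly many points: differences of such points are among the finitely
    many lattice points in [F]. *)
Lemma cnt_slab_le (W W' : set V) : bounded_set W -> bounded_set W' ->
  bounded_distance_equivalent (model_set Gamma W) (model_set Gamma W') ->
  exists C : nat, forall a b,
    (cnt (slab fst W a b) <= cnt (slab fst W' a b) + C)%N.
Proof.
move=> bW bW' [K [K0 [chi [[chiL chi_inj _] chiK]]]].
have fin A a b := @slab_finite fst A a b (fun=> erefl).
have /bounded_setP[M M0 WM] := bW'.
pose F := Gamma `&` [set g : T | `|g.1| <= K /\ `|g.2| <= M + M].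
have short u : (cnt (slab fst W' u (u + K)) <= cnt F)%N.
  have [[g0 [Gg0 [/andP[g0u g0K] Wg0]]]|nz] :=
      pselect (exists g, slab fst W' u (u + K) g); last first.
    have -> : slab fst W' u (u + K) = set0.
      by apply/seteqP; split=> // g zg; apply: nz; exists g.
    by rewrite /cnt fset_set0.
  apply: (@cnt_inj _ _ _ (fun g => g - g0)).
  - exact: fin.
  - exact: finite_lattice_window.
  - move=> g [Gg [/andP[gu gK] Wg]]; split; first exact: latticeB.
    split; first by rewrite /= ler_norml; apply/andP; split; lra.
    by apply: le_trans (ler_normB _ _) _; apply: lerD; exact: WM.
  - by move=> g h _ _ /addIr.
have /choice[f fP] : forall g : T, exists h : T, Gamma g /\ W g.2 ->
    [/\ Gamma h, W' h.2 & h.1 = chi g.1].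
  move=> g; have [[Gg Wg]|nW] := pselect (Gamma g /\ W g.2); last by exists g.
  have [|h [Gh Wh] hg] := chiL g.1; first by exists g.
  by exists h.
exists (cnt F + cnt F)%N => a b.
have [ab|ba] := leP a b; last first.
  have -> : slab fst W a b = set0.
    apply/seteqP; split=> // g [_ [/andP[ag gb] _]].
    by have := lt_le_trans ba (le_trans ag gb); rewrite ltxx.
  by rewrite /cnt fset_set0.
apply: (@leq_trans (cnt (slab fst W' (a - K) (a - K + K) `|`
                         (slab fst W' a b `|` slab fst W' b (b + K))))).
  apply: (@cnt_inj _ _ _ f); first exact: fin.
  - by rewrite !finite_setU; split; [exact: fin|split; exact: fin].
  - move=> g [Gg [/andP[ag gb] Wg]]; have [Gh Wh hE] := fP g (conj Gg Wg).
    have := chiK g.1; rewrite -hE => /(_ (ex_intro2 _ _ g (conj Gg Wg) erefl)).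
    rewrite ler_norml => /andP[h1 h2].
    have [ha|ah] := leP (f g).1 a.
      by left; split=> //; split=> //; apply/andP; split; lra.
    right; have [hb|bh] := leP (f g).1 b.
      by left; split=> //; split=> //; rewrite (ltW ah).
    by right; split=> //; split=> //; apply/andP; split; lra.
  - move=> g h [Gg [_ Wg]] [Gh [_ Wh]] fgh.
    have [_ _ gE] := fP g (conj Gg Wg); have [_ _ hE] := fP h (conj Gh Wh).
    apply: p1_inj => //; apply: chi_inj.
    + by apply: mem_set; exists g.
    + by apply: mem_set; exists h.
    + by rewrite -gE -hE fgh.
apply: leq_trans (cntU _ _) _; rewrite ?finite_setU;
  [exact: fin|by split; exact: fin|].
have cnt2 := cntU (fin W' a b bW') (fin W' b (b + K) bW').
apply: leq_trans (leq_add (short (a - K)) cnt2) _.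
by rewrite addnCA !leq_add2l short.
Qed.

End ModelSetCounts.

(** * Assembling a decomposition *)

Section Boundaries.
Context {R : realType} {d : nat}.
Notation V := 'rV[R]_d.
Implicit Types (x y : V) (H : seq V) (A : set V).

Lemma closed_boundary A : closed (boundary A).
Proof.
rewrite /boundary setDE; apply: closedI; first exact: closed_closure.
by apply: open_closedC; exact: open_interior.
Qed.

Lemma closed_pattern_boundary (W W' : set V) H :
  closed (pattern_boundary W W' H).
Proof.
have closed_shift A h : closed [set x : V | boundary A (x + h)].
  apply: (@preimage_closed _ _ (fun x : V => x + h) (boundary A)).
    move=> x _; apply: continuousD; [exact: cvg_id|exact: cst_continuous].
  exact: closed_boundary.
elim: H => [|h H IH].
  rewrite (_ : pattern_boundary _ _ _ = set0); first exact: closed0.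
  by apply/seteqP; split=> // x [].
rewrite (_ : pattern_boundary _ _ _ =
  [set x | boundary W (x + h)] `|` [set x | boundary W' (x + h)] `|`
  pattern_boundary W W' H).
  by apply: closedU => //; exact: closedU.
apply/seteqP; split=> x.
  move=> [k]; rewrite inE => /orP[/eqP -> [bk|bk]|Hk bk].
  - by left; left.
  - by left; right.
  - by right; exists k.
case=> [[bx|bx]|[k Hk bk]].
- by exists h; [rewrite mem_head|left].
- by exists h; [rewrite mem_head|right].
- by exists k; rewrite // inE Hk orbT.
Qed.

Lemma boundary_bounded A (M : R) : (forall v, A v -> `|v| <= M) ->
  forall v, boundary A v -> `|v| <= M.
Proof.
move=> AM v [cv _].
have clM : closed [set u : V | `|u| <= M].
  apply: (@preimage_closed _ _ (fun u : V => `|u|) [set a : R | a <= M]).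
    by move=> u _; exact: norm_continuous.
  exact: closed_le.
by have := closure_subset AM cv; rewrite -(iffLR (closure_id _) clM).
Qed.

End Boundaries.

Section Assembly.
Context {R : realType} {d : nat}.
Notation V := 'rV[R]_d.
Hypothesis d_gt0 : (0 < d)%N.

(** The sets [Q i] may be replaced by admissible pieces up to null sets. The
    pieces that are null are thrown away and, together with their translates,
    added to the exceptional set; the others meet every set with null
    complement, so that all the parts of the two partitions are nonempty. *)
Lemma equidecomposable_assembly (pieces : set V -> Prop) (G W W' : set V)
    (I : choiceType) (s : seq I) (g : I -> V) (Q : I -> set V) (E0 : set V) :
  uniq s -> {in s, forall i, G (g i)} ->
  {in s, forall i, exists P E, [/\ pieces P, lebesgue_null E &
                                   forall x, ~ E x -> (Q i x <-> P x)]} ->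
  {in s, forall i x, Q i x -> W x /\ W' (x + g i)} ->
  lebesgue_null E0 ->
  (forall x, ~ E0 x -> W x -> exists2 i, i \in s & Q i x) ->
  (forall x, ~ E0 x -> W' x -> exists2 i, i \in s & Q i (x - g i)) ->
  {in s &, forall i j x, Q i x -> Q j x -> i = j} ->
  {in s &, forall i j x, Q i (x - g i) -> Q j (x - g j) -> i = j} ->
  equidecomposable pieces G W W'.
Proof.
move=> s_uniq sG approx QW E0_null coverW coverW' inj inj'.
have /choice[P] : forall i, exists P, i \in s -> exists E, [/\ pieces P,
    lebesgue_null E & forall x, ~ E x -> (Q i x <-> P x)].
  move=> i; have [si|_] := boolP (i \in s); last by exists set0.
  by have [P [E PE]] := approx i si; exists P => _; exists E.
move=> /(_ _) P_ex.
have /choice[E EP] : forall i, exists E, i \in s -> [/\ pieces (P i),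
    lebesgue_null E & forall x, ~ E x -> (Q i x <-> P i x)].
  move=> i; have [si|_] := boolP (i \in s); last by exists set0.
  by have [E PE] := P_ex i si; exists E.
pose Z i := if i \in s then
  E i `|` (if `[< lebesgue_null (P i) >] then P i else set0) else set0.
have Z_null i : lebesgue_null (Z i).
  rewrite /Z; case: ifP => [si|_]; last exact: lebesgue_null0.
  have [_ Ei _] := EP i si; apply: lebesgue_nullU => //.
  by case: asboolP => // _; exact: lebesgue_null0.
pose bad := E0 `|` \big[setU/set0]_(i <- s) (Z i `|` translate (Z i) (g i)).
have bad_null : lebesgue_null bad.
  apply: lebesgue_nullU => //; apply: (lebesgue_null_bigcup d_gt0) => i.
  by apply: lebesgue_nullU => //; exact: lebesgue_null_translate.
have okZ i x : i \in s -> ~ bad x -> ~ Z i x.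
  move=> si nb zx; apply: nb; right; rewrite -bigcup_seq.
  by exists i => //; left.
have okZt i x : i \in s -> ~ bad x -> ~ Z i (x - g i).
  move=> si nb zx; apply: nb; right; rewrite -bigcup_seq.
  by exists i => //; right; exists (x - g i) => //; rewrite subrK.
have PQ i x : i \in s -> ~ Z i x -> (Q i x <-> P i x).
  move=> si nz; have [_ _] := EP i si; apply=> Ex; apply: nz.
  by rewrite /Z si; left.
have fat i x : i \in s -> ~ Z i x -> P i x -> ~ lebesgue_null (P i).
  move=> si nz Px Pn; apply: nz; rewrite /Z si; right.
  by rewrite asboolT.
pose s' := [seq i <- s | ~~ `[< lebesgue_null (P i) >]].
have s's i : i \in s' -> i \in s by rewrite mem_filter => /andP[].
have s'_uniq : uniq s' by exact: filter_uniq.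
pose t (j : 'I_(size s')) := tnth (in_tuple s') j.
have ts' j : t j \in s' by exact: mem_tnth.
have ts j : t j \in s by exact: s's.
have t_inj j k : t j = t k -> j = k.
  by move=> jk; apply/(tuple_uniqP (in_tuple s') s'_uniq).
have st i : i \in s' -> exists j, t j = i.
  by move=> /(tnthP (in_tuple s'))[j ->]; exists j.
have t_fat j : ~ lebesgue_null (P (t j)).
  by have := ts' j; rewrite mem_filter => /andP[/asboolPn].
have in_s' i x : i \in s -> ~ Z i x -> P i x -> i \in s'.
  move=> si nz Px; rewrite mem_filter si andbT; apply/asboolPn.
  exact: fat nz Px.
exists (size s'), (fun j => P (t j)), (fun j => g (t j)), (~` bad); split.
- by move=> j; have [] := EP _ (ts j).
- by move=> j; exact: sG.
- by rewrite setCK.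
- split.
  + apply/seteqP; split=> x.
      move=> [j _ [Px nb]]; split=> //.
      by have /(PQ _ _ (ts j) (okZ _ _ (ts j) nb))/(QW _ (ts j))[] := Px.
    move=> [Wx nb]; have nE0 : ~ E0 x by move=> Ex; apply: nb; left.
    have [i si Qx] := coverW x nE0 Wx; have nz := okZ i x si nb.
    have Px := iffLR (PQ i x si nz) Qx.
    by have [j tj] := st i (in_s' i x si nz Px); exists j => //; rewrite tj.
  + move=> j k _ _ [x [[Pj nb] [Pk _]]]; apply: t_inj.
    by apply: (inj _ _ (ts j) (ts k) x); apply/PQ => //; exact: okZ.
  + move=> j _; apply: contrapT => np; apply: (t_fat j).
    apply: lebesgue_nullS bad_null => x Px; apply: contrapT => nb.
    by apply: np; exists x.
- split.
  + apply/seteqP; split=> x.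
      move=> [j _ [[y Py yx] nb]]; split=> //; rewrite -yx.
      have nz : ~ Z (t j) y.
        by have := okZt (t j) x (ts j) nb; rewrite -yx addrK.
      by have /(PQ _ _ (ts j) nz)/(QW _ (ts j))[] := Py.
    move=> [Wx nb]; have nE0 : ~ E0 x by move=> Ex; apply: nb; left.
    have [i si Qx] := coverW' x nE0 Wx; have nz := okZt i x si nb.
    have Px := iffLR (PQ i _ si nz) Qx.
    have [j tj] := st i (in_s' i _ si nz Px); exists j => //; rewrite tj.
    by split=> //; exists (x - g i); rewrite ?subrK.
  + move=> j k _ _ [x [[[y Pj yx] nb] [[z Pk zx] _]]]; apply: t_inj.
    apply: (inj' _ _ (ts j) (ts k) x); apply/PQ => //; try exact: okZt.
      by rewrite -yx addrK.
    by rewrite -zx addrK.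
  + move=> j _; apply: contrapT => np; apply: (t_fat j).
    apply: lebesgue_nullS (lebesgue_null_translate (- g (t j)) bad_null) => x Px.
    exists (x + g (t j)); last by rewrite addrK.
    by apply: contrapT => nb; apply: np; exists (x + g (t j)); split=> //; exists x.
Qed.

End Assembly.

Section Reversal.
Context {R : realType} {d : nat}.
Notation V := 'rV[R]_d.
Notation T := (R * V)%type.
Variables (Gamma : set T) (p : T -> R) (W W' : set V).
Hypothesis window_fin : forall x a b, finite_set (window Gamma p W W' x a b).
Let q (g : T) := - p g.

Lemma discrepancy_reverse x a b :
  discrepancy Gamma q W' W x a b = - discrepancy Gamma p W W' x (- b) (- a).
Proof.
have wE : window Gamma q W' W x a b = window Gamma p W W' x (- b) (- a).
  by apply/seteqP; split=> g [Gg [gab gx]]; split=> //; split; move: gab gx;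
    rewrite /q sgn_swap oppr_eq0 // lerNl lerNr andbC // opprK.
rewrite /discrepancy wE !fsbig_finite // -sumrN.
by apply: eq_bigr => g _; rewrite sgn_swap.
Qed.

Lemma matched_reverse x g h :
  matched Gamma q W' W x h g -> matched Gamma p W W' x g h.
Proof.
move=> [[Gh Gg] [hx gx] [gh D0] Ha Hb].
move: hx gx gh; rewrite !(sgn_swap W W') /q ltrN2 => hx gx gh.
move: D0; rewrite discrepancy_reverse !opprK => D0.
split=> //.
- by split; [exact: oppr_inj|rewrite -[LHS]opprK hx].
- by split=> //; rewrite -[LHS]opprK D0 oppr0.
- move=> k Gk kx /andP[gk kh]; have := Hb k Gk.
  rewrite (sgn_swap W W') oppr_eq0 kx /q ltrN2 kh lerN2 gk => /(_ isT isT).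
  by rewrite discrepancy_reverse !opprK lerN2.
- move=> k Gk kx /andP[gk kh]; have := Ha k Gk.
  rewrite (sgn_swap W W') oppr_eq0 kx /q ltrN2 gk lerN2 kh => /(_ isT isT).
  by rewrite discrepancy_reverse !opprK lerNr.
Qed.

End Reversal.

(** * The decomposition of model sets *)

Section Transfer.
Context {R : realType} {d : nat}.
Notation V := 'rV[R]_d.
Notation T := (R * V)%type.
Variables (Gamma : set T) (W W' : set V).
Hypothesis Gamma_lattice : lattice Gamma.
Variable M : R.
Hypothesis W_bounded : forall v, W v -> `|v| <= M.
Hypothesis W'_bounded : forall v, W' v -> `|v| <= M.
Local Notation sg := (sgn W W').
Local Notation disc := (discrepancy Gamma fst W W').
Local Notation mtch := (matched Gamma fst W W').

(** Whether [f] is the partner of [0] only depends on the lattice points with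
    height between [0] and [f.1]. *)
Lemma matched_local (x y : V) (f : T) : Gamma f ->
  (forall h, Gamma h -> 0 <= h.1 <= f.1 -> sg (x + h.2) = sg (y + h.2)) ->
  mtch x 0 f -> mtch y 0 f.
Proof.
move=> Gf xy [[G0 _] [x0 xf] [f0 D0] Ha Hb].
have DE a b : 0 <= a -> b <= f.1 -> disc x a b = disc y a b.
  move=> a0 bf; have range h : a <= h.1 <= b -> 0 <= h.1 <= f.1.
    by move=> /andP[ah hb]; rewrite (le_trans a0 ah) (le_trans hb bf).
  have wE : window Gamma fst W W' x a b = window Gamma fst W W' y a b.
    by apply/seteqP; split=> h [Gh [hab hx]]; split=> //; split=> //;
      move: hx; rewrite xy //; exact: range.
  rewrite /discrepancy wE; apply: eq_fsbigr => h /set_mem[Gh [hab _]].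
  by apply: xy => //; exact: range.
split=> //.
- by rewrite -!xy ?lexx ?ltW.
- by rewrite -DE.
- move=> k Gk ky /andP[k0 kf]; rewrite -DE ?lexx ?(ltW kf) //; apply: Ha => //.
    by rewrite xy // k0 ltW.
  by rewrite k0.
- move=> k Gk ky /andP[k0 kf]; rewrite -DE ?lexx ?(ltW k0) //; apply: Hb => //.
    by rewrite xy // kf ltW.
  by rewrite k0.
Qed.

(** The piece that moves by [f.2]: the common part of [W] and [W'] stays in
    place, the rest of [W] moves to its partner. *)
Definition piece (f : T) : set V :=
  [set x | W x /\ (f = 0 /\ W' x \/ mtch x 0 f)].

Lemma piece_image f x : piece f x -> W x /\ W' (x + f.2).
Proof.
move=> [Wx [[-> W'x]|[_ [_ fx] _ _ _]]]; split=> //; first by rewrite addr0.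
by have [] := iffLR (sgnN1 _ _ _) fx.
Qed.

Let pB (g h : T) : (g - h).1 = g.1 - h.1 := erefl.
Let p_norm (g : T) : `|g.1| = `|g.1| := erefl.
Hypothesis p1_inj : forall g h, Gamma g -> Gamma h -> g.1 = h.1 -> g = h.

Lemma piece_inj f f' x : piece f x -> piece f' x -> f = f'.
Proof.
have N f0 : mtch x 0 f0 -> ~ W' x.
  by move=> [_ [+ _] _ _ _]; rewrite addr0 => /sgn1[].
move=> [_ [[-> W'x]|xf]] [_ [[-> W'x']|xf']] //.
- by have := N _ xf'.
- by have := N _ xf.
- exact: matched_right_unique xf xf'.
Qed.

Lemma piece_image_inj f f' x : piece f (x - f.2) -> piece f' (x - f'.2) -> f = f'.
Proof.
have N f0 : mtch (x - f0.2) 0 f0 -> ~ W x.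
  by move=> [_ [_ +] _ _ _]; rewrite subrK => /sgnN1[].
have Mf f0 : mtch (x - f0.2) 0 f0 -> mtch x (- f0) 0.
  move=> xf; have Gf : Gamma f0 by case: xf => -[].
  have := matched_shift Gamma_lattice pB (x := x) (k := - f0)
    (latticeN Gamma_lattice Gf) xf.
  by rewrite add0r subrr.
move=> [Wx [[f0 W'x]|xf]] [Wx' [[f0' W'x']|xf']].
- by rewrite f0 f0'.
- by move: Wx; rewrite f0 subr0 => /(N _ xf').
- by move: Wx'; rewrite f0' subr0 => /(N _ xf).
- exact: oppr_inj (matched_left_unique p1_inj (Mf _ xf) (Mf _ xf')).
Qed.

(** For [x] in [W], lattice points with second projection longer than [M + M]
    lead out of [W] and [W'], so that the partner of [x] is read off from a
    finite pattern. *)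
Lemma piece_determined (L : R) (H : seq V) f : 0 <= L ->
  (forall h, Gamma h -> `|h.1| <= L -> `|h.2| <= M + M -> h.2 \in H) ->
  f.1 <= L -> Gamma f -> pattern_determined W W' H (piece f).
Proof.
move=> L0 HP fL Gf x y same [Wx xf].
have sgE h : h \in H -> sg (x + h) = sg (y + h).
  move=> /same[WE W'E]; rewrite /sgn.
  by congr (_ - _); congr (nat_of_bool _)%:Z; apply/asbool_equiv_eq.
have H0 : (0 : V) \in H.
  apply: (HP 0 (lattice0 Gamma_lattice)); rewrite /= normr0 //.
  by rewrite addr_ge0 // (le_trans (normr_ge0 x)) // W_bounded.
have [WE W'E] := same 0 H0; rewrite !addr0 in WE W'E.
have Wy : W y by exact/WE.
split=> //; case: xf => [[f0 W'x]|xf]; [by left; split=> //; exact/W'E|right].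
apply: matched_local xf => // h Gh /andP[h0 hf].
have [hM|Mh] := leP `|h.2| (M + M).
  by apply/sgE/HP => //; rewrite ger0_norm // (le_trans hf).
have far v : W v -> sg (v + h.2) = 0.
  move=> Wv; apply/eqP/negPn/negP => /(sgn_bounded W_bounded W'_bounded) vh.
  have : `|h.2| <= M + M.
    have -> : h.2 = (v + h.2) - v by rewrite addrC addKr.
    by apply: le_trans (ler_normB _ _) _; rewrite lerD // W_bounded.
  by rewrite leNgt Mh.
by rewrite !far.
Qed.

Lemma regular_off_boundary (q : T -> R) (L : R) (H : seq V) (g : T) :
  (forall h, Gamma h -> `|h.1| <= L -> `|h.2| <= M + M -> h.2 \in H) ->
  (forall h k, q (h - k) = q h - q k) -> (forall h, `|q h| = `|h.1|) ->
  Gamma g -> `|g.2| <= M -> ~ pattern_boundary W W' H g.2 ->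
  regular Gamma q W W' (q g) (q g + L).
Proof.
move=> HP qB q_norm Gg gM gb k Gk /andP[gk kL].
have off A : (forall v, A v -> `|v| <= M) -> boundary A k.2 -> k.2 - g.2 \in H.
  move=> AM bk; apply: (HP (k - g)) => //; first exact: latticeB.
    by rewrite -q_norm qB ger0_norm ?subr_ge0 // lerBlDl.
  apply: le_trans (ler_normB _ _) _; rewrite lerD //.
  exact: boundary_bounded AM _ bk.
split=> bk; apply: gb; exists (k.2 - g.2).
- exact: off bk.
- by left; rewrite addrC subrK.
- exact: off bk.
- by right; rewrite addrC subrK.
Qed.

End Transfer.

Lemma dense_near (T : topologicalType) (S P : set T) (x : T) :
  dense S -> nbhs x P -> exists2 y, S y & P y.
Proof.
move=> S_dense xP; have [|y [Py Sy]] := S_dense (interior P) _ (@open_interior _ P).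
  by exists x.
by exists y => //; exact: interior_subset.
Qed.

Section Main.
Context {R : realType} {d : nat}.
Notation V := 'rV[R]_d.
Notation T := (R * V)%type.

(** Off the null set [E0], both covering properties of the pieces only depend on
    the pattern of a point along [far_list], which near that point is also the
    pattern of some [g.2] with [g] in the lattice. There the partners are
    provided by [regular_matched], applied once in each direction of time. *)
Lemma model_sets_equidecomposable (d_gt0 : (0 < d)%N) (Gamma : set T)
    (pieces : set V -> Prop) (W W' : set V) :
  lattice Gamma -> (forall g h, Gamma g -> Gamma h -> g.1 = h.1 -> g = h) ->
  dense (snd @` Gamma) ->
  riemann_measurable W -> riemann_measurable W' ->
  (forall P H, P `<=` W -> pattern_determined W W' H P ->
     exists P' E, [/\ pieces P', lebesgue_null E &
                      forall x, ~ E x -> (P x <-> P' x)]) ->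
  bounded_distance_equivalent (model_set Gamma W) (model_set Gamma W') ->
  equidecomposable pieces (snd @` Gamma) W W'.
Proof.
move=> Gl p1_inj p2_dense [bW W0] [bW' W'0] approx bde.
pose p : T -> R := fst; pose q (g : T) := - p g.
have pB g h : p (g - h) = p g - p h by [].
have qB g h : q (g - h) = q g - q h by rewrite /q /= opprD.
have p_norm g : `|p g| = `|g.1| by [].
have q_norm g : `|q g| = `|g.1| by rewrite /q normrN.
have q_inj g h : Gamma g -> Gamma h -> q g = q h -> g = h.
  by move=> Gg Gh /oppr_inj; exact: p1_inj.
have [M WM W'M] : exists2 M : R, (forall v, W v -> `|v| <= M)
                               & (forall v, W' v -> `|v| <= M).
  have /bounded_setP[M M0 WM] := bounded_setU bW bW'.
  by exists M => v Wv; apply: WM; [left|right].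
have [C CP] := cnt_slab_le Gl p1_inj bW bW' bde.
have [C' C'P] :=
  cnt_slab_le Gl p1_inj bW' bW (bounded_distance_equivalent_sym bde).
have discr_le a b : discrepancy Gamma p W W' 0 a b <= C%:Z.
  by rewrite discrepancy_cnt // lerBlDl -PoszD lez_nat CP.
have slabq A a b : slab Gamma q A a b = slab Gamma p A (- b) (- a).
  by apply/seteqP; split=> g [Gg [gab Ag]]; split=> //; split=> //; move: gab;
    rewrite /q lerNl lerNr andbC // opprK.
have discr_le' a b : discrepancy Gamma q W' W 0 a b <= C'%:Z.
  by rewrite discrepancy_cnt // !slabq lerBlDl -PoszD lez_nat C'P.
have [L1 L1_0 up] :=
  regular_matched Gl pB p_norm p1_inj WM W'M d_gt0 p2_dense discr_le.
have [L2 L2_0 down] :=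
  regular_matched Gl qB q_norm q_inj W'M WM d_gt0 p2_dense discr_le'.
pose L := L1 + L2; have L0 : 0 <= L by rewrite addr_ge0 // ltW.
have window_list (A B : R) : exists s : seq T, uniq s /\
    forall g, g \in s <-> Gamma g /\ (`|g.1| <= A /\ `|g.2| <= B).
  have /finite_seqP[s sE] := finite_lattice_window Gl A B.
  exists (undup s); split=> [|g]; first exact: undup_uniq.
  rewrite mem_undup; split=> [gs|Gg]; first by have : [set` s] g by []; rewrite -sE.
  have : (Gamma `&` [set g | `|g.1| <= A /\ `|g.2| <= B]) g by [].
  by rewrite sE.
have [s [s_uniq sP]] := window_list L (M + M).
have [r [_ rP]] := window_list (L + L) (M + M + (M + M)).
(* A point [x - f.2] with the pattern on [near_list] prescribed by [piece f] is
   controlled by the pattern of [x] on [far_list]. *)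
pose near_list := [seq h.2 | h <- s]; pose far_list := [seq h.2 | h <- r].
have near_listP h : Gamma h -> `|h.1| <= L -> `|h.2| <= M + M ->
    h.2 \in near_list.
  by move=> Gh hL hM; apply: map_f; apply/sP.
have near_le g : g \in s -> g.1 <= L.
  by move=> /sP[_ [gL _]]; exact: le_trans (ler_norm _) gL.
have near_Gamma g : g \in s -> Gamma g by move=> /sP[].
have near_far (h : V) (f : T) : h \in near_list -> f \in s -> h - f.2 \in far_list.
  move=> /mapP[k /sP[Gk [kL kM]] ->] /sP[Gf [fL fM]].
  have -> : k.2 - f.2 = (k - f).2 by [].
  apply: map_f; apply/rP; split; first exact: latticeB.
  by split; apply: le_trans (ler_normB _ _) _; rewrite lerD.
have s0 : 0 <= M -> (0 : T) \in s.
  by move=> M0; apply/sP; split; [exact: lattice0|rewrite /= !normr0 L0 addr_ge0].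
have near_sub_far (h : V) : 0 <= M -> h \in near_list -> h \in far_list.
  by move=> M_ge0 Hh; have := near_far h 0 Hh (s0 M_ge0); rewrite subr0.
have M0 (v : V) : `|v| <= M -> 0 <= M by exact: le_trans.
pose E0 := pattern_boundary W W' far_list.
have E0_null : lebesgue_null E0 by exact: pattern_boundary_null.
have reg_near (g : T) : 0 <= M -> ~ E0 g.2 ->
    ~ pattern_boundary W W' near_list g.2.
  move=> M_ge0 gE [h Hh bh]; apply: gE; exists h => //; exact: near_sub_far.
have approach x : ~ E0 x -> exists g,
    [/\ Gamma g, ~ E0 g.2 & same_pattern W W' far_list g.2 x].
  move=> nEx; have nx := near_same_pattern nEx.
  have nE : \forall y \near x, ~ E0 y.
    apply: open_nbhs_nbhs; split=> //; apply: closed_openC.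
    exact: closed_pattern_boundary.
  by have [_ [g Gg <-] [gE gx]] := dense_near p2_dense (filterI nE nx); exists g.
have pieceD f : f \in s -> pattern_determined W W' near_list (piece Gamma W W' f).
  move=> fs; apply: (piece_determined Gl WM W'M L0 near_listP) => //.
    exact: near_le.
  exact: near_Gamma.
have partner g h : Gamma g -> `|g.2| <= M -> `|h.2| <= M -> `|h.1 - g.1| <= L ->
    matched Gamma p W W' 0 g h ->
    h - g \in s /\ piece Gamma W W' (h - g) g.2.
  move=> Gg gM hM hL gh; have [[_ Gh] [gx _] _ _ _] := gh; split.
    apply/sP; split; first exact: latticeB.
    by split=> //; apply: le_trans (ler_normB _ _) _; rewrite lerD.
  split; first by move: gx; rewrite add0r => /sgn1[].
  right; have gh' : matched Gamma p W W' (g.2 + (- g).2) g h by rewrite /= subrr.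
  by have := matched_shift Gl pB (latticeN Gl Gg) gh'; rewrite subrr.
have regular_up g : Gamma g -> ~ E0 g.2 -> `|g.2| <= M ->
    regular Gamma p W W' (p g) (p g + L1).
  move=> Gg gE gM; have := regular_off_boundary Gl WM W'M near_listP pB p_norm
    Gg gM (reg_near g (M0 _ gM) gE).
  move=> reg k Gk /andP[gk kL]; apply: reg => //; rewrite gk.
  by apply: le_trans kL _; rewrite lerD2l lerDl ltW.
have regular_down g : Gamma g -> ~ E0 g.2 -> `|g.2| <= M ->
    regular Gamma q W' W (q g) (q g + L2).
  move=> Gg gE gM; have := regular_off_boundary Gl WM W'M near_listP qB q_norm
    Gg gM (reg_near g (M0 _ gM) gE).
  move=> reg k Gk /andP[gk kL]; apply/and_comm; apply: reg => //; rewrite gk.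
  by apply: le_trans kL _; rewrite lerD2l lerDr ltW.
have zero_piece x : W x -> W' x -> (0 : T) \in s /\ piece Gamma W W' 0 x.
  by move=> Wx W'x; split; [exact: s0 (M0 _ (WM _ Wx))|split=> //; left].
have zero_far v : W v \/ W' v -> (0 : V) \in far_list.
  move=> Wv; have M_ge0 : 0 <= M by apply: (M0 v); case: Wv => [/WM|/W'M].
  by apply: near_sub_far => //; apply: (map_f snd (s0 M_ge0)).
apply: (equidecomposable_assembly d_gt0 (s := s) (g := snd)
  (Q := piece Gamma W W') (E0 := E0)) => //.
- by move=> g /near_Gamma Gg; exists g.
- by move=> f fs; apply: (approx _ near_list); [move=> x []|exact: pieceD].
- by move=> f _ x; exact: piece_image.
- move=> x xE Wx; have [W'x|nW'x] := pselect (W' x).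
    by have [? ?] := zero_piece x Wx W'x; exists 0.
  have [g [Gg gE gx]] := approach x xE.
  have [WE W'E] := gx 0 (zero_far x (or_introl Wx)); rewrite !addr0 in WE W'E.
  have Wg : W g.2 by exact/WE.
  have g1 : sgn W W' g.2 = 1 by apply/sgn1; split=> // /W'E.
  have [h gh hL] := up g Gg g1 (regular_up g Gg gE (WM _ Wg)).
  have [[_ Gh] [_ hx] [ltgh _] _ _] := gh.
  have [||fs fg] := partner g h Gg (WM _ Wg) _ _ gh.
  + by move: hx; rewrite add0r => /sgnN1[/W'M].
  + move: ltgh hL; rewrite /p => ltgh hL; rewrite ger0_norm ?subr_ge0 ?(ltW ltgh) //.
    by rewrite lerBlDl (le_trans hL) // lerD2l lerDl ltW.
  exists (h - g) => //; apply: pieceD fg => // k Hk; apply: gx.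
  exact: near_sub_far (M0 _ (WM _ Wg)) Hk.
- move=> x xE W'x; have [Wx|nWx] := pselect (W x).
    by have [? ?] := zero_piece x Wx W'x; exists 0; rewrite ?subr0.
  have [h [Gh hE hx]] := approach x xE.
  have [WE W'E] := hx 0 (zero_far x (or_intror W'x)); rewrite !addr0 in WE W'E.
  have W'h : W' h.2 by exact/W'E.
  have h1 : sgn W' W h.2 = 1 by apply/sgn1; split=> // /WE.
  have [g hg gL] := down h Gh h1 (regular_down h Gh hE (W'M _ W'h)).
  have {}hg : matched Gamma p W W' 0 g h.
    apply: matched_reverse hg.
    exact: (window_finite Gl p_norm WM W'M).
  have [[Gg _] [gx _] [ltgh _] _ _] := hg.
  have gM : `|g.2| <= M by move: gx; rewrite add0r => /sgn1[/WM].
  have [|fs fg] := partner g h Gg gM (W'M _ W'h) _ hg.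
  + move: ltgh gL; rewrite /q /p => ltgh gL.
    rewrite ger0_norm ?subr_ge0 ?(ltW ltgh) //.
    by have := ltW L1_0; rewrite /L; lra.
  exists (h - g) => //; apply: (pieceD _ fs g.2) fg => k Hk.
  have := hx _ (near_far k (h - g) Hk fs).
  have -> : h.2 + (k - (h - g).2) = g.2 + k.
    by rewrite /= opprB addrCA [h.2 + _]addrCA subrr addr0 addrC.
  by have -> : x + (k - (h - g).2) = x - (h - g).2 + k by rewrite addrA addrAC.
- by move=> f f' _ _ x; exact: piece_inj.
- by move=> f f' _ _ x; exact: piece_image_inj.
Qed.

End Main.

Theorem theorem5p1 (R : realType) (d : nat) (d_ge1 : (1 <= d)%N)
    (Gamma : set (R * 'rV[R]_d)) (Gamma_lattice : lattice Gamma)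
    (p1_inj : {in Gamma &, injective fst})
    (p2_dense : dense (snd @` Gamma))
    (W W' : set 'rV[R]_d) :
  (riemann_measurable W -> riemann_measurable W' ->
   bounded_distance_equivalent (model_set Gamma W) (model_set Gamma W') ->
   equidecomposable riemann_measurable (snd @` Gamma) W W') /\
  (polytope W -> polytope W' ->
   bounded_distance_equivalent (model_set Gamma W) (model_set Gamma W') ->
   equidecomposable polytope (snd @` Gamma) W W').
Proof.
have inj g h : Gamma g -> Gamma h -> g.1 = h.1 -> g = h.
  by move=> Gg Gh; apply: p1_inj; exact: mem_set.
split=> [rW rW'|pW pW'].
  apply: model_sets_equidecomposable => // P H PW HP; exists P, set0; split=> //.
    exact: riemann_measurable_piece HP.
  exact: lebesgue_null0.
apply: model_sets_equidecomposable => //; try exact: polytope_riemann_measurable.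
by move=> P H PW HP; exact: polytope_piece HP.
Qed.
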